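(* Let $(M,g)$ be a non-compact, arithmetic, hyperbolic $2$-manifold. Then for every $\ell\in\mathcal{L}_p(M,g)$ and every $k\in\mathbb{N}$, there is a $k$-term arithmetic progression in $\mathcal{L}_p(M,g)$ each of whose terms is an integer multiple of $\ell$.
   Context: A hyperbolic $2$-manifold is $\mathbb{H}^2/\Gamma$ with the metric of constant curvature $-1$; it is arithmetic if $\Gamma$ is an arithmetic lattice in $\mathrm{Isom}(\mathbb{H}^2)$. (In the non-compact case this is equivalent to $M$ being commensurable with the modular surface $\mathbb{H}^2/\mathrm{PSL}(2,\mathbb{Z})$, i.e. the two having a common finite Riemannian orbifold cover.) For a Riemannian manifold $(M,g)$ and a conjugacy class $[\gamma]$ in $\pi_1(M)$, let $L_{[\gamma]}$ be the set of lengths of all closed geodesics in $M$ representing $[\gamma]$ (possibly empty). A conjugacy class $[\gamma]$ is primitive if $\gamma$ is not a proper power of some other element of $\pi_1(M)$. The primitive length spectrum $\mathcal{L}_p(M,g)$ is the multiset union of the $L_{[\gamma]}$ over all primitive conjugacy classes. A multiset $S$ of real numbers contains a $k$-term arithmetic progression if it contains numbers $x_1<\cdots<x_k$ with $x_j=aj+b$ for some $a,b$ (constant progressions are not allowed). *)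

(* Defs.v *)
From HB Require Import structures.
From mathcomp Require Import all_boot all_order all_algebra.
From mathcomp Require Import all_classical all_reals all_analysis.
From mathcomp Require Import complex.

Set Implicit Arguments.
Unset Strict Implicit.
Unset Printing Implicit Defensive.

Import Order.TTheory GRing.Theory Num.Theory.
Import numFieldNormedType.Exports.

Local Open Scope classical_set_scope.
Local Open Scope ring_scope.

(** * The hyperbolic plane (upper half-plane model) *)

Record H2 (R : realType) := UHP {
  uhp_val :> R[i];
  uhp_Im_gt0 : 0 < complex.Im uhp_val
}.

HB.instance Definition _ (R : realType) := gen_eqMixin (H2 R).
HB.instance Definition _ (R : realType) := gen_choiceMixin (H2 R).

Definition uhp_coord (R : realType) (z : H2 R) : R * R :=
  (complex.Re z, complex.Im z).

HB.instance Definition _ (R : realType) :=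
  Topological.copy (H2 R) (initial_topology (@uhp_coord R)).

Definition arcosh (R : realType) (x : R) : R :=
  ln (x + Num.sqrt (x ^+ 2 - 1)).

(* The distance of the metric (dx^2 + dy^2) / y^2, of curvature -1. *)
Definition hyp_dist (R : realType) (z w : H2 R) : R :=
  arcosh (1 + ((complex.Re z - complex.Re w) ^+ 2 +
               (complex.Im z - complex.Im w) ^+ 2) /
              (2 * complex.Im z * complex.Im w)).

(** * The group Isom(H^2), orientation-reversing isometries included *)

Record isom (R : realType) := Isom {
  isom_fun :> H2 R -> H2 R;
  isom_inv : H2 R -> H2 R;
  isom_funK : cancel isom_fun isom_inv;
  isom_invK : cancel isom_inv isom_fun;
  isom_dist : forall z w, hyp_dist (isom_fun z) (isom_fun w) = hyp_dist z w
}.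

Lemma isomP (R : realType) (f g : isom R) : (forall z, f z = g z) -> f = g.
Proof.
case: f g => [f f' fK f'K fd] [g g' gK g'K gd] /= fg.
have {fg} Efg : f = g by apply/funext.
subst g.
have Efg' : f' = g' by apply/funext => z; rewrite -[z in LHS]g'K fK.
subst g'.
by congr Isom; exact: Prop_irrelevance.
Qed.

HB.instance Definition _ (R : realType) := gen_eqMixin (isom R).
HB.instance Definition _ (R : realType) := gen_choiceMixin (isom R).

Definition isom_one (R : realType) : isom R :=
  @Isom R id id (fun _ => erefl) (fun _ => erefl) (fun _ _ => erefl).

Fact isom_inv_dist (R : realType) (f : isom R) (z w : H2 R) :
  hyp_dist (isom_inv f z) (isom_inv f w) = hyp_dist z w.
Proof. by rewrite -(isom_dist f) !isom_invK. Qed.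

Definition isom_opp (R : realType) (f : isom R) : isom R :=
  Isom (isom_invK f) (isom_funK f) (isom_inv_dist f).

Fact isom_comp_dist (R : realType) (f g : isom R) (z w : H2 R) :
  hyp_dist ((f \o g) z) ((f \o g) w) = hyp_dist z w.
Proof. by rewrite /= !isom_dist. Qed.

Definition isom_mul (R : realType) (f g : isom R) : isom R :=
  Isom (can_comp (isom_funK f) (isom_funK g))
       (can_comp (isom_invK g) (isom_invK f))
       (isom_comp_dist f g).

Fact isom_mulA (R : realType) : associative (@isom_mul R).
Proof. by move=> f g h; apply: isomP. Qed.
Fact isom_mul1 (R : realType) : left_id (@isom_one R) (@isom_mul R).
Proof. by move=> f; apply: isomP. Qed.
Fact isom_mulr1 (R : realType) : right_id (@isom_one R) (@isom_mul R).
Proof. by move=> f; apply: isomP. Qed.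
Fact isom_mulV (R : realType) :
  left_inverse (@isom_one R) (@isom_opp R) (@isom_mul R).
Proof. by move=> f; apply: isomP => z /=; rewrite isom_funK. Qed.
Fact isom_mulrV (R : realType) :
  right_inverse (@isom_one R) (@isom_opp R) (@isom_mul R).
Proof. by move=> f; apply: isomP => z /=; rewrite isom_invK. Qed.

HB.instance Definition _ (R : realType) := isGroup.Build (isom R)
  (@isom_mulA R) (@isom_mul1 R) (@isom_mulr1 R) (@isom_mulV R) (@isom_mulrV R).

(** * Subgroups and commensurability *)

Definition is_subgroup (G : groupType) (A : set G) : Prop :=
  A 1%g /\ forall f g, A f -> A g -> A (f * g^-1)%g.

Definition finite_index (G : groupType) (B A : set G) : Prop :=
  B `<=` A /\ finite_set [set [set (f * h)%g | h in B] | f in A].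

(* H^2/D is, up to isometry, a finite Riemannian orbifold cover of H^2/A. *)
Definition finite_orbifold_cover (R : realType) (D A : set (isom R)) : Prop :=
  exists g : isom R, finite_index [set (g * f * g^-1)%g | f in D] A.

(* H^2/A and H^2/B have a common finite Riemannian orbifold cover. *)
Definition commensurable (R : realType) (A B : set (isom R)) : Prop :=
  exists D : set (isom R),
    [/\ is_subgroup D, finite_orbifold_cover D A & finite_orbifold_cover D B].

(* PSL(2,Z), acting by z |-> (a z + b) / (c z + d). *)
Definition modular_group (R : realType) : set (isom R) :=
  [set f : isom R | exists a b c d : int, a * d - b * c = 1 /\
     forall z : H2 R, (f z : R[i]) =
       (a%:~R * (z : R[i]) + b%:~R) / (c%:~R * (z : R[i]) + d%:~R)].

(** * Hyperbolic 2-manifolds *)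

(* The manifold H^2/deck; its fundamental group is identified with deck,
   acting by deck transformations. *)
Record hyperbolic_surface (R : realType) := HyperbolicSurface {
  deck : set (isom R);
  deck_subgroup : is_subgroup deck;
  deck_properly_discontinuous : forall (z : H2 R) (r : R),
    finite_set [set f | deck f /\ hyp_dist z (f z) <= r];
  deck_free : forall (f : isom R) (z : H2 R), deck f -> f z = z -> f = 1%g
}.

Definition same_orbit (R : realType) (M : hyperbolic_surface R)
  (z w : H2 R) : bool := `[< exists2 f : isom R, deck M f & w = f z >].

Fact same_orbit_refl (R : realType) (M : hyperbolic_surface R) :
  reflexive (same_orbit M).
Proof.
by move=> z; apply/asboolP; exists 1%g => //; have [] := deck_subgroup M.
Qed.

Fact same_orbit_sym (R : realType) (M : hyperbolic_surface R) :
  symmetric (same_orbit M).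
Proof.
have imp z w : same_orbit M z w -> same_orbit M w z.
  move=> /asboolP[f Mf ->]; apply/asboolP; have [M1 MV] := deck_subgroup M.
  exists (1 * f^-1)%g; first exact: MV.
  by rewrite mul1g /=; exact: esym (isom_funK f z).
by move=> z w; apply/idP/idP; exact: imp.
Qed.

Fact same_orbit_trans (R : realType) (M : hyperbolic_surface R) :
  transitive (same_orbit M).
Proof.
move=> w z u /asboolP[f Mf ->] /asboolP[g Mg ->]; apply/asboolP.
have [M1 MV] := deck_subgroup M.
exists (g * f)%g => //.
by rewrite -[f]invgK -[(f^-1)%g]mul1g; apply: (MV) => //; exact: MV.
Qed.

Canonical same_orbit_equiv (R : realType) (M : hyperbolic_surface R) :=
  EquivRel (same_orbit M) (same_orbit_refl M) (same_orbit_sym M)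
    (@same_orbit_trans R M).

Definition surface_space (R : realType) (M : hyperbolic_surface R) :
    topologicalType :=
  quotient_topology {eq_quot (same_orbit M)}%qT.

(* Among non-compact hyperbolic surfaces, the arithmetic ones are those
   commensurable with the modular surface. *)
Definition noncompact_arithmetic (R : realType) (M : hyperbolic_surface R) :
    Prop :=
  ~ compact [set: surface_space M] /\ commensurable (deck M) (@modular_group R).

(** * Closed geodesics and the primitive length spectrum *)

(* Unit-speed geodesics: curves that locally realize the distance. *)
Definition geodesic (R : realType) (c : R -> H2 R) : Prop :=
  forall t : R, exists2 e : R, 0 < e &
    forall s s' : R, `|s - t| < e -> `|s' - t| < e ->
      hyp_dist (c s) (c s') = `|s - s'|.

Definition conj_class (G : groupType) (A : set G) (f : G) : set G :=
  [set (h * f * h^-1)%g | h in A].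

(* A closed geodesic of length l lifts to a geodesic c of H^2, and represents
   the conjugacy class of the deck transformation f with c (t + l) = f (c t);
   closed geodesics are not constant, whence l > 0. *)
Definition closed_geodesic_lengths (R : realType) (C : set (isom R)) : set R :=
  [set l | 0 < l /\ exists (f : isom R) (c : R -> H2 R),
     [/\ C f, geodesic c & forall t : R, c (t + l) = f (c t)]].

Definition primitive (G : groupType) (A : set G) (f : G) : Prop :=
  A f /\ ~ exists (g : G) (n : nat),
    [/\ A g, g <> f, (2 <= n)%N & f = (g ^+ n)%g].

Definition primitive_class (G : groupType) (A : set G) (C : set G) : Prop :=
  exists2 f : G, primitive A f & C = conj_class A f.

(* The multiplicity of x is the number of indices i with ms_val i = x. *)
Record multiset (T : Type) := Multiset {
  ms_index : Type;
  ms_val : ms_index -> T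
}.

Definition ms_mem (T : Type) (S : multiset T) (x : T) : Prop :=
  exists i : ms_index S, ms_val i = x.

Definition primitive_length_spectrum (R : realType)
    (M : hyperbolic_surface R) : multiset R :=
  @Multiset R
    {p : set (isom R) * R |
       primitive_class (deck M) p.1 /\ closed_geodesic_lengths p.1 p.2}
    (fun p => (sval p).2).

(** * Arithmetic progressions *)

Definition arith_progression_in (R : realType) (S : multiset R) (k : nat)
    (x : nat -> R) : Prop :=
  [/\ exists a b : R, forall j, (1 <= j <= k)%N -> x j = a * j%:R + b,
      forall i j, (1 <= i)%N -> (i < j)%N -> (j <= k)%N -> x i < x j &
      forall j, (1 <= j <= k)%N -> ms_mem S (x j)].

(* Main.v *)
(* After conjugating, the deck group G and PSL(2,Z) share a subgroup D of finite
   index in both; fix E > 0 such that x^E lies in D for all x in G or PSL(2,Z).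
   If f in G translates a geodesic by l, then f^E is an integral matrix, and its
   trace gives that e^(El) + e^(-El) is an integer; this Lucas sequence being
   periodic modulo 2 E^2, the trace 2 cosh L is congruent to 2 modulo 2 E^2 for
   all multiples L of some multiple of l.  For such L, write 2 cosh L = 2 + E b
   with E | b: the word w = V^E T^b, where T z = z + 1 and V z = z / (z + 1),
   lies in D, has trace 2 cosh L, and so translates its axis by 2 L.  For L
   large, w is primitive in G: its period is essentially one deep excursion into
   the cusp, and a root d of w would take a high point of that excursion to
   another one, forcing d to normalize the translations, which w does not.  So
   all large multiples of some multiple of l are primitive lengths. *)

Require Import Defs.
From mathcomp Require Import all_boot all_order all_algebra.
From mathcomp Require Import all_classical all_reals all_analysis.
From mathcomp Require Import complex.
From mathcomp Require Import ring lra zify.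

Set Implicit Arguments.
Unset Strict Implicit.
Unset Printing Implicit Defensive.

Import Order.TTheory GRing.Theory Num.Theory.
Import numFieldNormedType.Exports.

Local Open Scope classical_set_scope.
Local Open Scope ring_scope.

(** * Hyperbolic cosine and sine, and the inverse [arcosh] *)

Section HyperbolicFunctions.
Variable R : realType.
Implicit Types x y : R.

Definition ch x : R := (expR x + expR (- x)) / 2.
Definition sh x : R := (expR x - expR (- x)) / 2.

Lemma expRVE x : expR (- x) * expR x = 1.
Proof. by rewrite expRN mulVf // gt_eqF // expR_gt0. Qed.

Lemma ch_ge1 x : 1 <= ch x.
Proof.
rewrite /ch; have := expRVE x; have := expR_gt0 x; have := expR_gt0 (- x).
move: (expR x) (expR (- x)) => a b b0 a0 ba.
rewrite ler_pdivlMr // mul1r -subr_ge0.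
have -> : a + b - 2 = b * (a - 1) ^+ 2 + (1 - b * a) * (a - 2) by ring.
by rewrite ba subrr mul0r addr0 mulr_ge0 ?sqr_ge0 // ltW.
Qed.

Lemma chN x : ch (- x) = ch x.
Proof. by rewrite /ch opprK addrC. Qed.

Lemma ch_norm x : ch `|x| = ch x.
Proof. by case: (ger0P x); rewrite ?chN. Qed.

Lemma ch_inj x y : 0 <= x -> 0 <= y -> ch x = ch y -> x = y.
Proof.
move=> x0 y0 e; apply: expR_inj; move: e; rewrite /ch.
have := expRVE x; have := expRVE y; have := expR_gt0 (- x).
have := expR_gt0 (- y).
have : 1 <= expR x by rewrite -expR0 ler_expR.
have : 1 <= expR y by rewrite -expR0 ler_expR.
move: (expR x) (expR y) (expR (- x)) (expR (- y)) => a b a' b'.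
move=> b1 a1 b'0 a'0 bb aa e.
(* If the second factor vanishes, then [a] and [b], both at least 1, are both equal to 1. *)
have : (a - b) * (a * b - 1) = 0.
  have -> : (a - b) * (a * b - 1) =
    a * b * (a + a' - (b + b')) - (a' * a - 1) * b + (b' * b - 1) * a by ring.
  by rewrite aa bb !subrr !mul0r; nra.
move/eqP; rewrite mulf_eq0 => /orP[|] /eqP; nra.
Qed.

Lemma arcosh_ge0 y : 1 <= y -> 0 <= arcosh y.
Proof.
by move=> y1; apply: ln_ge0; have := sqrtr_ge0 (y ^+ 2 - 1); lra.
Qed.

Lemma ch_arcosh y : 1 <= y -> ch (arcosh y) = y.
Proof.
move=> y1; rewrite /ch /arcosh.
have s0 := sqrtr_ge0 (y ^+ 2 - 1).
have s2 : Num.sqrt (y ^+ 2 - 1) ^+ 2 = y ^+ 2 - 1 by rewrite sqr_sqrtr //; nra.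
move: (Num.sqrt _) s0 s2 => s s0 s2.
have p : 0 < y + s by lra.
rewrite expRN lnK //.
have -> : (y + s)^-1 = y - s.
  have p0 : y + s != 0 by rewrite gt_eqF.
  apply: (mulfI p0); rewrite mulfV //.
  have -> : (y + s) * (y - s) = y ^+ 2 - s ^+ 2 by ring.
  by rewrite s2 subKr.
by field.
Qed.

Lemma arcosh_ch x : arcosh (ch x) = `|x|.
Proof.
apply: ch_inj; rewrite ?normr_ge0 ?arcosh_ge0 ?ch_ge1 //.
by rewrite ch_arcosh ?ch_ge1 // ch_norm.
Qed.

Lemma sh_gt0 x : 0 < x -> 0 < sh x.
Proof.
by move=> x0; rewrite divr_gt0 // subr_gt0 ltr_expR; lra.
Qed.

End HyperbolicFunctions.

(** * The hyperboloid model and its bilinear form *)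

Section Coordinates.
Variable R : realType.
Implicit Types z w : H2 R.

Local Notation Re := complex.Re.
Local Notation Im := complex.Im.

(* The point x + iy of the half-plane corresponds to the point with matrix
   [[cA, cB], [cB, cC]] of the hyperboloid det = 1 of symmetric matrices. *)
Definition cA z : R := (Re z ^+ 2 + Im z ^+ 2) / Im z.
Definition cB z : R := Re z / Im z.
Definition cC z : R := (Im z)^-1.

Lemma Im_gt0 z : 0 < Im z. Proof. exact: uhp_Im_gt0. Qed.
Lemma Im_neq0 z : Im z != 0. Proof. by rewrite gt_eqF // Im_gt0. Qed.

Lemma H2_inj z w : Re z = Re w -> Im z = Im w -> z = w.
Proof.
case: z w => [[x y] y0] [[x' y'] y'0] /= -> e; subst y'.
by congr UHP; exact: Prop_irrelevance.
Qed.

Lemma cC_gt0 z : 0 < cC z.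
Proof. by rewrite /cC invr_gt0 Im_gt0. Qed.

Lemma coord_inj z w : cB z = cB w -> cC z = cC w -> z = w.
Proof.
rewrite /cB /cC => eB /invr_inj eC; apply: H2_inj => //.
by move: eB; rewrite eC => /mulIf; apply; rewrite invr_neq0 // Im_neq0.
Qed.

Lemma coord_det z : cA z * cC z - cB z ^+ 2 = 1.
Proof. by rewrite /cA /cB /cC; field; exact: Im_neq0. Qed.

(** The polarization of the determinant [cA * cC - cB ^+ 2], that is, the Lorentzian inner product.
    On the hyperboloid it is the hyperbolic cosine of the distance. *)
Definition bil z w : R := (cA z * cC w + cC z * cA w - 2 * cB z * cB w) / 2.

Lemma bilE z w : bil z w = 1 + ((Re z - Re w) ^+ 2 + (Im z - Im w) ^+ 2) /
              (2 * Im z * Im w).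
Proof. by rewrite /bil /cA /cB /cC; field; rewrite !Im_neq0. Qed.

Lemma bil_ge1 z w : 1 <= bil z w.
Proof.
rewrite bilE lerDl divr_ge0 ?addr_ge0 ?sqr_ge0 //.
by rewrite !mulr_ge0 // ltW // Im_gt0.
Qed.

Lemma hyp_distE z w : hyp_dist z w = arcosh (bil z w).
Proof. by rewrite bilE. Qed.

Lemma ch_hyp_dist z w : ch (hyp_dist z w) = bil z w.
Proof. by rewrite hyp_distE ch_arcosh // bil_ge1. Qed.

Lemma bil_isom (f : isom R) z w : bil (f z) (f w) = bil z w.
Proof. by rewrite -!ch_hyp_dist isom_dist. Qed.

Lemma hyp_distP z w (t : R) : hyp_dist z w = `|t| <-> bil z w = ch t.
Proof.
split=> [e|e]; first by rewrite -ch_hyp_dist e ch_norm.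
by rewrite hyp_distE e arcosh_ch.
Qed.

(** The form has signature (1, 2), so it is definite on the orthogonal complement of the timelike
    vector [z]. Concretely, for [z] = x + iy the two equations combine into (b - c x)^2 + (c y)^2 =
    0. *)
Lemma null_orthogonal_eq0 z (a b c : R) :
  a * cC z + c * cA z - 2 * b * cB z = 0 -> a * c - b ^+ 2 = 0 ->
  [/\ a = 0, b = 0 & c = 0].
Proof.
rewrite /cA /cB /cC; have y0 := Im_gt0 z; move: (Re z) (Im z) y0 => x y y0 e n.
have e1 : a + c * (x ^+ 2 + y ^+ 2) - 2 * b * x = 0.
  have -> : a + c * (x ^+ 2 + y ^+ 2) - 2 * b * x =
    y * (a / y + c * ((x ^+ 2 + y ^+ 2) / y) - 2 * b * (x / y)).
    by field; rewrite gt_eqF.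
  by rewrite e mulr0.
have e2 : (b - c * x) ^+ 2 + (c * y) ^+ 2 = 0.
  have -> : (b - c * x) ^+ 2 + (c * y) ^+ 2 =
    c * (a + c * (x ^+ 2 + y ^+ 2) - 2 * b * x) - (a * c - b ^+ 2) by ring.
  by rewrite e1 n mulr0 subr0.
move/eqP: e2; rewrite paddr_eq0 ?sqr_ge0 // !sqrf_eq0 mulf_eq0 (gt_eqF y0) orbF.
move=> /andP[/eqP b0 /eqP c0]; subst c.
have b00 : b = 0 by lra.
by subst b; split => //; lra.
Qed.

(** Points at the mutual distances of parameters [s], [a], [b] on a line are linearly dependent
    vectors of the hyperboloid model. This interpolation formula turns the metric notion of geodesic
    into explicit coordinates. *)
Lemma collinear_coord (zs za zb : H2 R) (s a b : R) :
  bil zs za = ch (s - a) -> bil zs zb = ch (s - b) -> bil za zb = ch (a - b) ->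
  [/\ sh (b - a) * cA zs = sh (b - s) * cA za + sh (s - a) * cA zb,
      sh (b - a) * cB zs = sh (b - s) * cB za + sh (s - a) * cB zb &
      sh (b - a) * cC zs = sh (b - s) * cC za + sh (s - a) * cC zb].
Proof.
move=> h1 h2 h3.
(* V is orthogonal to all three points, so it is a null vector orthogonal to the
   timelike vector zs, hence zero. *)
pose V (K : H2 R -> R) := sh (b - a) * K zs - sh (b - s) * K za - sh (s - a) * K zb.
suff [/eqP vA /eqP vB /eqP vC] : [/\ V cA = 0, V cB = 0 & V cC = 0].
  by split; apply/eqP; rewrite -subr_eq0 opprD addrA.
have ds := coord_det zs; have da := coord_det za; have db := coord_det zb.
move: h1 h2 h3; rewrite /bil /V.
rewrite /ch /sh !expRD !opprB !expRD.
have := expRVE a; have := expRVE b; have := expRVE s.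
move: (expR a) (expR b) (expR s) (expR (- a)) (expR (- b)) (expR (- s)).
move=> ea eb es ia ib i's is1 ib1 ia1 h1 h2 h3.
pose Sba := (eb * ia - ea * ib) / 2; pose Sbs := (eb * i's - es * ib) / 2.
pose Ssa := (es * ia - ea * i's) / 2.
rewrite -/Sba -/Sbs -/Ssa.
pose Csa := (es * ia + ea * i's) / 2; pose Csb := (es * ib + eb * i's) / 2.
pose Cab := (ea * ib + eb * ia) / 2.
(* [k1], [k2], [k3] are the inner products of [V] with [zs], [za], [zb]; they vanish by the addition
   formulas. *)
have k1 : Sba - Sbs * Csa - Ssa * Csb = 0.
  rewrite /Sba /Sbs /Ssa /Csa /Csb.
  have -> : (eb * ia - ea * ib) / 2 -
    (eb * i's - es * ib) / 2 * ((es * ia + ea * i's) / 2) -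
    (es * ia - ea * i's) / 2 * ((es * ib + eb * i's) / 2) =
    (eb * ia - ea * ib) / 2 * (1 - i's * es) by field.
  by rewrite is1 subrr mulr0.
have k2 : Sba * Csa - Sbs - Ssa * Cab = 0.
  rewrite /Sba /Sbs /Ssa /Csa /Cab.
  have -> : (eb * ia - ea * ib) / 2 * ((es * ia + ea * i's) / 2) -
    (eb * i's - es * ib) / 2 -
    (es * ia - ea * i's) / 2 * ((ea * ib + eb * ia) / 2) =
    (eb * i's - es * ib) / 2 * (ia * ea - 1) by field.
  by rewrite ia1 subrr mulr0.
have k3 : Sba * Csb - Sbs * Cab - Ssa = 0.
  rewrite /Sba /Sbs /Ssa /Csb /Cab.
  have -> : (eb * ia - ea * ib) / 2 * ((es * ib + eb * i's) / 2) -
    (eb * i's - es * ib) / 2 * ((ea * ib + eb * ia) / 2) -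
    (es * ia - ea * i's) / 2 =
    (es * ia - ea * i's) / 2 * (ib * eb - 1) by field.
  by rewrite ib1 subrr mulr0.
rewrite -/Csa in h1; rewrite -/Csb in h2; rewrite -/Cab in h3.
move: h1 h2 h3 k1 k2 k3 ds da db.
move: Sba Sbs Ssa Csa Csb Cab => Sba Sbs Ssa Csa Csb Cab h1 h2 h3 k1 k2 k3.
move=> ds da db.
apply: (@null_orthogonal_eq0 zs).
- have -> : (Sba * cA zs - Sbs * cA za - Ssa * cA zb) * cC zs +
    (Sba * cC zs - Sbs * cC za - Ssa * cC zb) * cA zs -
    2 * (Sba * cB zs - Sbs * cB za - Ssa * cB zb) * cB zs =
    2 * (Sba * (cA zs * cC zs - cB zs ^+ 2)
     - Sbs * ((cA zs * cC za + cC zs * cA za - 2 * cB zs * cB za) / 2)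
     - Ssa * ((cA zs * cC zb + cC zs * cA zb - 2 * cB zs * cB zb) / 2)) by field.
  by rewrite ds h1 h2 mulr1 k1 mulr0.
- have -> : (Sba * cA zs - Sbs * cA za - Ssa * cA zb) *
    (Sba * cC zs - Sbs * cC za - Ssa * cC zb) -
    (Sba * cB zs - Sbs * cB za - Ssa * cB zb) ^+ 2 =
    Sba ^+ 2 * (cA zs * cC zs - cB zs ^+ 2)
    + Sbs ^+ 2 * (cA za * cC za - cB za ^+ 2)
    + Ssa ^+ 2 * (cA zb * cC zb - cB zb ^+ 2)
    - 2 * Sba * Sbs * ((cA zs * cC za + cC zs * cA za - 2 * cB zs * cB za) / 2)
    - 2 * Sba * Ssa * ((cA zs * cC zb + cC zs * cA zb - 2 * cB zs * cB zb) / 2)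
    + 2 * Sbs * Ssa * ((cA za * cC zb + cC za * cA zb - 2 * cB za * cB zb) / 2)
    by field.
  rewrite ds da db h1 h2 h3 !mulr1.
  have -> : Sba ^+ 2 + Sbs ^+ 2 + Ssa ^+ 2 - 2 * Sba * Sbs * Csa
    - 2 * Sba * Ssa * Csb + 2 * Sbs * Ssa * Cab =
    Sba * (Sba - Sbs * Csa - Ssa * Csb) - Sbs * (Sba * Csa - Sbs - Ssa * Cab)
    - Ssa * (Sba * Csb - Sbs * Cab - Ssa) by ring.
  by rewrite k1 k2 k3 !mulr0 !subr0.
Qed.

End Coordinates.

(** * Geodesics as exponential curves, and the isometries translating them *)

Section ExponentialCurves.
Variable R : realType.
Implicit Types (k : R -> R) (f : H2 R -> H2 R) (g h : R -> H2 R).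

(** The linear system for the coefficients has determinant [expR (s - s') - expR (s' - s)], nonzero
    for distinct parameters. *)
Lemma expR_pair_agree (p q p' q' s s' : R) : s != s' ->
  p * expR s + q * expR (- s) = p' * expR s + q' * expR (- s) ->
  p * expR s' + q * expR (- s') = p' * expR s' + q' * expR (- s') ->
  p = p' /\ q = q'.
Proof.
move=> ss' h h'.
have d0 : expR (s - s') - expR (s' - s) != 0.
  by rewrite subr_eq0; apply/eqP => /expR_inj e; move/eqP: ss'; apply; lra.
move: d0; rewrite !expRD; move: h h'.
move: (expR_gt0 s) (expR_gt0 s') (expRVE s) (expRVE s').
move: (expR s) (expR s') (expR (- s)) (expR (- s')) => a b ia ib a0 b0 aE bE h h'.
move=> d0.
have : (p - p') * (a * ib - b * ia) = 0.
  have -> : (p - p') * (a * ib - b * ia) =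
    (p * a + q * ia - (p' * a + q' * ia)) * ib -
    (p * b + q * ib - (p' * b + q' * ib)) * ia by ring.
  by rewrite h h' !subrr !mul0r subrr.
move/eqP; rewrite mulf_eq0 (negbTE d0) orbF subr_eq0 => /eqP pp'; subst p'.
split=> //; move/addrI: h => /mulIf; apply.
by apply: contra_eq_neq aE => ->; rewrite mul0r eq_sym oner_eq0.
Qed.

Lemma expR_pair_eq (p q p' q' : R) :
  (forall t, p * expR t + q * expR (- t) = p' * expR t + q' * expR (- t)) ->
  p = p' /\ q = q'.
Proof.
by move=> h; apply: (@expR_pair_agree _ _ _ _ 0 1) => //; rewrite eq_sym oner_eq0.
Qed.

(** Local expressions agree at two points of any overlap, hence have the same coefficients; these
    are locally constant functions on the line, so constant. *)
Lemma expR_pair_local_global k :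
  (forall t, exists2 e : R, 0 < e & exists p q, forall s, `|s - t| < e ->
     k s = p * expR s + q * expR (- s)) ->
  exists p q, forall t, k t = p * expR t + q * expR (- t).
Proof.
move=> loc.
have /choice[F FP] : forall t, exists x : R * R * R, 0 < x.2 /\
    forall s, `|s - t| < x.2 -> k s = x.1.1 * expR s + x.1.2 * expR (- s).
  by move=> t; have [e e0 [p [q h]]] := loc t; exists (p, q, e).
have Floc t s : `|s - t| < (F t).2 -> (F s).1 = (F t).1.
  move=> st; have [t0 ht] := FP t; have [s0 hs] := FP s.
  (* With this radius, [s] and [r + s] are two distinct points lying in both neighbourhoods. *)
  set r := Num.min (F s).2 ((F t).2 - `|s - t|) / 2.
  have r0 : 0 < r by rewrite divr_gt0 // lt_min s0 subr_gt0.
  have rs : r < (F s).2.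
    have : Num.min (F s).2 ((F t).2 - `|s - t|) <= (F s).2 by rewrite ge_min lexx.
    by rewrite /r; lra.
  have rt : r < (F t).2 - `|s - t|.
    have : Num.min (F s).2 ((F t).2 - `|s - t|) <= (F t).2 - `|s - t|.
      by rewrite ge_min lexx orbT.
    by rewrite /r in r0 *; lra.
  have e1 := hs s; rewrite subrr normr0 in e1.
  have e2 := hs (s + r); rewrite [s + r]addrC addrK gtr0_norm // in e2.
  have e3 := ht (r + s).
  have r3 : `|r + s - t| < (F t).2.
    rewrite -addrA; apply: le_lt_trans (ler_normD _ _) _.
    by rewrite gtr0_norm //; lra.
  have := @expR_pair_agree (F s).1.1 (F s).1.2 (F t).1.1 (F t).1.2 s (r + s).
  case; first by apply/eqP => ?; lra.
  - by rewrite -e1 // -ht.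
  - by rewrite -e2 // -e3.
  - by case: (F s).1 (F t).1 => [? ?] [? ?] /= -> ->.
(* A locally constant function has zero derivative everywhere, hence is constant. *)
have Fcst (g : R * R -> R) s t : g (F s).1 = g (F t).1.
  apply: (@is_derive_0_is_cst R (fun x => g (F x).1)) => x.
  apply: (@near_eq_is_derive R R R (cst (g (F x).1))).
    apply: filterS (@nbhsx_ballx R R x _ (FP x).1) => y.
    by rewrite /ball /= distrC => /Floc ->.
exists (F 0).1.1, (F 0).1.2 => t.
have [t0 ->] := FP t; last by rewrite subrr normr0.
by rewrite (Fcst fst t 0) (Fcst snd t 0).
Qed.

Lemma geodesic_coord_global (K : H2 R -> R) g :
  (forall (zs za zb : H2 R) (s a b : R),
     bil zs za = ch (s - a) -> bil zs zb = ch (s - b) ->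
     bil za zb = ch (a - b) ->
     sh (b - a) * K zs = sh (b - s) * K za + sh (s - a) * K zb) ->
  geodesic g -> exists p q, forall t, K (g t) = p * expR t + q * expR (- t).
Proof.
move=> coll gc; apply: (@expR_pair_local_global (K \o g)) => t.
have [e e0 he] := gc t; exists e => //.
pose b := t + e / 2.
have bt : `|b - t| < e by rewrite /b addrC addKr gtr0_norm; lra.
have tt : `|t - t| < e by rewrite subrr normr0.
have S0 : 0 < sh (b - t) by apply: sh_gt0; rewrite /b; lra.
(* The coefficients come from expanding sh (b - s) and sh (s - t) in e^s and e^-s in the
   interpolation formula. *)
exists ((K (g b) * expR (- t) - K (g t) * expR (- b)) / (2 * sh (b - t))).
exists ((K (g t) * expR b - K (g b) * expR t) / (2 * sh (b - t))).
move=> s st.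
have h := @coll (g s) (g t) (g b) s t b.
have {}h : sh (b - t) * K (g s) = sh (b - s) * K (g t) + sh (s - t) * K (g b).
  by apply: h; apply/hyp_distP; apply: he.
apply: (mulfI (lt0r_neq0 S0)); rewrite /= h {1 2}/sh !opprB !expRD.
by field; rewrite gt_eqF.
Qed.

(** In the hyperboloid model the curve is P e^t + Q e^-t; for such curves P and Q turn out to be
    null vectors, representing the two endpoints at infinity. *)
Definition exp_curve g (pA pB pC qA qB qC : R) := forall t,
  [/\ cA (g t) = pA * expR t + qA * expR (- t),
      cB (g t) = pB * expR t + qB * expR (- t) &
      cC (g t) = pC * expR t + qC * expR (- t)].

Lemma geodesic_exp_curve g : geodesic g ->
  exists pA pB pC qA qB qC, exp_curve g pA pB pC qA qB qC.
Proof.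
move=> gc.
have [||pA [qA hA]] := @geodesic_coord_global (@cA R) g; rewrite //.
  by move=> > h1 h2 h3; have [] := collinear_coord h1 h2 h3.
have [||pB [qB hB]] := @geodesic_coord_global (@cB R) g; rewrite //.
  by move=> > h1 h2 h3; have [] := collinear_coord h1 h2 h3.
have [||pC [qC hC]] := @geodesic_coord_global (@cC R) g; rewrite //.
  by move=> > h1 h2 h3; have [] := collinear_coord h1 h2 h3.
by exists pA, pB, pC, qA, qB, qC => t; split.
Qed.

(** The equation det = 1 along the curve reads X e^(2t) + Y + Z e^(-2t) = 0. Its instances at 0, t
    and -t for a single t > 0 already force X = Y = Z = 0. *)
Lemma exp_curve_norm g pA pB pC qA qB qC : exp_curve g pA pB pC qA qB qC ->
  [/\ pA * pC = pB ^+ 2, qA * qC = qB ^+ 2 &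
      pA * qC + qA * pC - 2 * pB * qB = 1].
Proof.
move=> h.
pose X := pA * pC - pB ^+ 2; pose Z := qA * qC - qB ^+ 2.
pose Y := pA * qC + qA * pC - 2 * pB * qB - 1.
have e t : X * expR t ^+ 2 + Y + Z * expR (- t) ^+ 2 = 0.
  have := coord_det (g t); have [-> -> ->] := h t; rewrite /X /Y /Z.
  have := expRVE t; move: (expR t) (expR (- t)) => a b ab e.
  have -> : (pA * pC - pB ^+ 2) * a ^+ 2 +
    (pA * qC + qA * pC - 2 * pB * qB - 1) + (qA * qC - qB ^+ 2) * b ^+ 2 =
    ((pA * a + qA * b) * (pC * a + qC * b) - (pB * a + qB * b) ^+ 2 - 1) +
    (1 - b * a) * (pA * qC + qA * pC - 2 * pB * qB) by ring.
  by rewrite e ab !subrr mul0r addr0.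
have [t t0] : exists t : R, 0 < t by exists 1.
have := e t; have := e (- t); have := e 0.
rewrite opprK oppr0 expR0 expr1n.
have := expRVE t; have := expR_gt0 (- t).
have : 1 < expR t by rewrite -[X in X < _]expR0 ltr_expR.
move: (expR t) (expR (- t)) => a b a1 b0 ba h0 h1 h2.
have a0 : 0 < a by lra.
have b1 : b < 1.
  have bb : b * 1 < b * a by rewrite ltr_pM2l.
  by rewrite ba mulr1 in bb.
have XZ : (X - Z) * ((a - b) * (a + b)) = 0 by rewrite -subr_sqr; lra.
have ab0 : a - b != 0 by rewrite subr_eq0 gt_eqF //; lra.
have ab1 : a + b != 0 by rewrite gt_eqF //; lra.
have {}XZ : X = Z.
  apply/eqP; move/eqP: XZ.
  by rewrite !mulf_eq0 (negbTE ab0) (negbTE ab1) !orbF subr_eq0.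
have X0 : X * ((a - b) ^+ 2) = 0.
  have -> : X * (a - b) ^+ 2 = X * (a ^+ 2 + b ^+ 2) - 2 * X * (b * a) by ring.
  by rewrite ba; move: h0 h1; rewrite -XZ; lra.
have {}X0 : X = 0.
  by apply/eqP; move/eqP: X0; rewrite mulf_eq0 sqrf_eq0 (negbTE ab0) orbF.
have Z0 : Z = 0 by lra.
have Y0 : Y = 0 by lra.
by move: X0 Y0 Z0; rewrite /X /Y /Z => ? ? ?; split; lra.
Qed.

(** The congruence S -> M S M^T on symmetric matrices, with M = [[a, b], [c, d]]. For det M = 1 it
    is the fractional linear action of M, and M and -M give the same conditions. *)
Definition mobius_coord (f : H2 R -> H2 R) (a b c d : R) := forall z,
  [/\ cA (f z) = a ^+ 2 * cA z + 2 * a * b * cB z + b ^+ 2 * cC z,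
      cB (f z) = a * c * cA z + (a * d + b * c) * cB z + b * d * cC z &
      cC (f z) = c ^+ 2 * cA z + 2 * c * d * cB z + d ^+ 2 * cC z].

(** Comparing the coefficients of e^t and e^-t shows that P and Q are eigenvectors of the
    congruence, with eigenvalues e^L and e^-L. *)
Lemma translated_exp_curve f a b c d g L pA pB pC qA qB qC :
  mobius_coord f a b c d -> exp_curve g pA pB pC qA qB qC ->
  (forall t, g (t + L) = f (g t)) ->
  [/\ a ^+ 2 * pA + 2 * a * b * pB + b ^+ 2 * pC = expR L * pA,
      a * c * pA + (a * d + b * c) * pB + b * d * pC = expR L * pB &
      c ^+ 2 * pA + 2 * c * d * pB + d ^+ 2 * pC = expR L * pC] /\
  [/\ a ^+ 2 * qA + 2 * a * b * qB + b ^+ 2 * qC = expR (- L) * qA,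
      a * c * qA + (a * d + b * c) * qB + b * d * qC = expR (- L) * qB &
      c ^+ 2 * qA + 2 * c * d * qB + d ^+ 2 * qC = expR (- L) * qC].
Proof.
move=> mf eg tr.
have shift (p q p' q' : R) (K : H2 R -> R) :
    (forall t, K (g (t + L)) = p * expR t + q * expR (- t)) ->
    (forall t, K (g t) = p' * expR t + q' * expR (- t)) ->
    p = expR L * p' /\ q = expR (- L) * q'.
  move=> h h'; apply: expR_pair_eq => t.
  by rewrite -h h' opprD !expRD; ring.
have [||pA1 qA1] := @shift (a ^+ 2 * pA + 2 * a * b * pB + b ^+ 2 * pC)
  (a ^+ 2 * qA + 2 * a * b * qB + b ^+ 2 * qC) pA qA (@cA R).
- move=> t; rewrite tr; have [-> _ _] := mf (g t); have [-> -> ->] := eg t; ring.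
- by move=> t; have [] := eg t.
have [||pB1 qB1] := @shift (a * c * pA + (a * d + b * c) * pB + b * d * pC)
  (a * c * qA + (a * d + b * c) * qB + b * d * qC) pB qB (@cB R).
- move=> t; rewrite tr; have [_ -> _] := mf (g t); have [-> -> ->] := eg t; ring.
- by move=> t; have [] := eg t.
have [||pC1 qC1] := @shift (c ^+ 2 * pA + 2 * c * d * pB + d ^+ 2 * pC)
  (c ^+ 2 * qA + 2 * c * d * qB + d ^+ 2 * qC) pC qC (@cC R).
- move=> t; rewrite tr; have [_ _ ->] := mf (g t); have [-> -> ->] := eg t; ring.
- by move=> t; have [] := eg t.
by [].
Qed.

(* The hypothesis says that M P M^T = u P for M = [[a, b], [c, d]] and
   P = [[pA, pB], [pB, pC]]; with N = P J^-1, J the rotation by a right angle,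
   it becomes M N = u N M, whence (u + 1) N = u (tr M) N M by Cayley-Hamilton. *)
Lemma conjugation_eigen (a b c d u pA pB pC : R) : a * d - b * c = 1 -> u != 1 ->
  a ^+ 2 * pA + 2 * a * b * pB + b ^+ 2 * pC = u * pA ->
  a * c * pA + (a * d + b * c) * pB + b * d * pC = u * pB ->
  c ^+ 2 * pA + 2 * c * d * pB + d ^+ 2 * pC = u * pC ->
  [/\ (u + 1) * pB = u * (a + d) * (pB * a - pA * c),
      (u + 1) * pA = u * (a + d) * (pA * d - pB * b),
      (u + 1) * pC = u * (a + d) * (pC * a - pB * c) &
      (u + 1) * pB = u * (a + d) * (pB * d - pC * b)].
Proof.
move=> D u1 eA eB eC.
have z11 : a * pB + b * pC - u * (pB * a - pA * c) = 0.
  rewrite -[a * pB + b * pC]mul1r -D.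
  have -> : (a * d - b * c) * (a * pB + b * pC) - u * (pB * a - pA * c) =
    (a * c * pA + (a * d + b * c) * pB + b * d * pC - u * pB) * a -
    (a ^+ 2 * pA + 2 * a * b * pB + b ^+ 2 * pC - u * pA) * c by ring.
  by rewrite eA eB !subrr !mul0r subrr.
have z12 : - (a * pA + b * pB) - u * (pB * b - pA * d) = 0.
  rewrite -[- (a * pA + b * pB)]mul1r -D.
  have -> : (a * d - b * c) * - (a * pA + b * pB) - u * (pB * b - pA * d) =
    (a * c * pA + (a * d + b * c) * pB + b * d * pC - u * pB) * b -
    (a ^+ 2 * pA + 2 * a * b * pB + b ^+ 2 * pC - u * pA) * d by ring.
  by rewrite eA eB !subrr !mul0r subrr.
have z21 : c * pB + d * pC - u * (pC * a - pB * c) = 0.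
  rewrite -[c * pB + d * pC]mul1r -D.
  have -> : (a * d - b * c) * (c * pB + d * pC) - u * (pC * a - pB * c) =
    (c ^+ 2 * pA + 2 * c * d * pB + d ^+ 2 * pC - u * pC) * a -
    (a * c * pA + (a * d + b * c) * pB + b * d * pC - u * pB) * c by ring.
  by rewrite eC eB !subrr !mul0r subrr.
have z22 : - (c * pA + d * pB) - u * (pC * b - pB * d) = 0.
  rewrite -[- (c * pA + d * pB)]mul1r -D.
  have -> : (a * d - b * c) * - (c * pA + d * pB) - u * (pC * b - pB * d) =
    (c ^+ 2 * pA + 2 * c * d * pB + d ^+ 2 * pC - u * pC) * b -
    (a * c * pA + (a * d + b * c) * pB + b * d * pC - u * pB) * d by ring.
  by rewrite eC eB !subrr !mul0r subrr.
move: z11 z12 z21 z22.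
set Z11 := (X in X = 0 -> _); set Z12 := (X in _ -> X = 0 -> _).
set Z21 := (X in _ -> _ -> X = 0 -> _); set Z22 := (X in _ -> _ -> _ -> X = 0 -> _).
move=> z11 z12 z21 z22.
have u10 : u - 1 != 0 by rewrite subr_eq0.
split; apply: (mulfI u10); apply/eqP; rewrite -subr_eq0; apply/eqP.
- have -> : (u - 1) * ((u + 1) * pB) - (u - 1) * (u * (a + d) * (pB * a - pA * c))
    = a * Z11 + b * Z21 + u * (Z11 * a + Z12 * c) - (a + d) * Z11
      + (u ^+ 2 - 1) * (1 - (a * d - b * c)) * pB by rewrite /Z11 /Z12 /Z21; ring.
  by rewrite z11 z12 z21 D subrr !(mulr0, mul0r, addr0, subr0).
- have -> : (u - 1) * ((u + 1) * pA) - (u - 1) * (u * (a + d) * (pA * d - pB * b))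
    = - (a * Z12 + b * Z22 + u * (Z11 * b + Z12 * d) - (a + d) * Z12)
      + (u ^+ 2 - 1) * (1 - (a * d - b * c)) * pA by rewrite /Z11 /Z12 /Z22; ring.
  by rewrite z11 z12 z22 D subrr !(mulr0, mul0r, addr0, subr0, oppr0).
- have -> : (u - 1) * ((u + 1) * pC) - (u - 1) * (u * (a + d) * (pC * a - pB * c))
    = c * Z11 + d * Z21 + u * (Z21 * a + Z22 * c) - (a + d) * Z21
      + (u ^+ 2 - 1) * (1 - (a * d - b * c)) * pC by rewrite /Z11 /Z22 /Z21; ring.
  by rewrite z11 z22 z21 D subrr !(mulr0, mul0r, addr0, subr0).
- have -> : (u - 1) * ((u + 1) * pB) - (u - 1) * (u * (a + d) * (pB * d - pC * b))
    = - (c * Z12 + d * Z22 + u * (Z21 * b + Z22 * d) - (a + d) * Z22)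
      + (u ^+ 2 - 1) * (1 - (a * d - b * c)) * pB by rewrite /Z22 /Z12 /Z21; ring.
  by rewrite z22 z12 z21 D subrr !(mulr0, mul0r, addr0, subr0, oppr0).
Qed.

(** By [conjugation_eigen], N is annihilated on the right by (u + 1) - u (tr M) M, hence by the
    determinant of this matrix, which is [X]. Since N is nonzero by the normalization of the curve,
    [X] = 0. The trace appears squared because M is determined only up to sign. *)
Lemma translation_trace f a b c d g L : a * d - b * c = 1 -> L != 0 ->
  mobius_coord f a b c d -> geodesic g -> (forall t, g (t + L) = f (g t)) ->
  (a + d) ^+ 2 = expR L + expR (- L) + 2.
Proof.
move=> D L0 mf /geodesic_exp_curve[pA [pB [pC [qA [qB [qC eg]]]]]] tr.
have [[eA eB eC] _] := translated_exp_curve mf eg tr.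
have [n1 _ n3] := exp_curve_norm eg.
have u1 : expR L != 1.
  by apply: contra_neq L0 => u1; apply: expR_inj; rewrite u1 expR0.
have [r1 r2 r3 r4] := conjugation_eigen D u1 eA eB eC.
have := expRVE L; have := expR_gt0 L; move: (expR L) (expR (- L)) r1 r2 r3 r4 u1.
move=> u v r1 r2 r3 r4 u1 u0 vu.
pose X := (u + 1) ^+ 2 - u * (a + d) ^+ 2.
have X1 : X * pC = 0.
  have -> : X * pC = (u + 1 - u * (a + d) * d) *
      ((u + 1) * pC - u * (a + d) * (pC * a - pB * c))
    - u * (a + d) * c * ((u + 1) * pB - u * (a + d) * (pB * d - pC * b))
    + u ^+ 2 * (a + d) ^+ 2 * (1 - (a * d - b * c)) * pC by rewrite /X; ring.
  by rewrite {1}r3 {1}r4 D !subrr !(mulr0, mul0r, addr0, subr0).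
have X2 : X * pA = 0.
  have -> : X * pA = (u + 1 - u * (a + d) * a) *
      ((u + 1) * pA - u * (a + d) * (pA * d - pB * b))
    - u * (a + d) * b * ((u + 1) * pB - u * (a + d) * (pB * a - pA * c))
    + u ^+ 2 * (a + d) ^+ 2 * (1 - (a * d - b * c)) * pA by rewrite /X; ring.
  by rewrite {1}r1 {1}r2 D !subrr !(mulr0, mul0r, addr0, subr0).
have X0 : X = 0.
  apply/eqP/negPn/negP => X0.
  have pC0 : pC = 0 by apply: (mulfI X0); rewrite mulr0.
  have pA0 : pA = 0 by apply: (mulfI X0); rewrite mulr0.
  have pB0 : pB = 0 by apply/eqP; rewrite -sqrf_eq0 -n1 pA0 mul0r.
  by move: n3; rewrite pA0 pB0 pC0 => ?; lra.
apply: (mulfI (lt0r_neq0 u0)); rewrite !mulrDr [u * v]mulrC vu.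
by move: X0; rewrite /X => ?; lra.
Qed.

(** The null vectors P and Q of a translated geodesic are fixed up to scale by the fixed points of
    the map, and the normalization fixes the product of the two scales. What remains is a shift of
    the parameter. *)
Lemma axis_unique f a b c d g h L : a * d - b * c = 1 -> c != 0 -> L != 0 ->
  mobius_coord f a b c d -> geodesic g -> geodesic h ->
  (forall t, g (t + L) = f (g t)) -> (forall t, h (t + L) = f (h t)) ->
  exists tau, forall t, h t = g (t + tau).
Proof.
move=> D c0 L0 mf gg gh trg trh.
have T := translation_trace D L0 mf gg trg.
have [pA [pB [pC [qA [qB [qC eg]]]]]] := geodesic_exp_curve gg.
have [pA' [pB' [pC' [qA' [qB' [qC' eh]]]]]] := geodesic_exp_curve gh.
(* Here k is the endpoint at infinity belonging to the eigenvalue u: the null vector is proportional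
   to (k^2, k, 1). *)
have kappa u v xA xB xC : v * u = 1 -> 0 < u -> (a + d) ^+ 2 = u + v + 2 -> u != 1 ->
    a ^+ 2 * xA + 2 * a * b * xB + b ^+ 2 * xC = u * xA ->
    a * c * xA + (a * d + b * c) * xB + b * d * xC = u * xB ->
    c ^+ 2 * xA + 2 * c * d * xB + d ^+ 2 * xC = u * xC ->
    let k := (a - (u + 1) / (u * (a + d))) / c in xB = k * xC /\ xA = k * xB.
  move=> vu u0 Tu u1 eA eB eC k.
  have [r1 _ r3 _] := conjugation_eigen D u1 eA eB eC.
  have t0 : a + d != 0 by apply/eqP => t0; rewrite t0 in Tu; nra.
  have ut0 : u * (a + d) != 0 by rewrite mulf_neq0 // gt_eqF.
  have kc : k * c = a - (u + 1) / (u * (a + d)) by rewrite divfK.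
  have ukc : u * (a + d) * (k * c) = u * (a + d) * a - (u + 1).
    by rewrite kc mulrBr [_ * (_ / _)]mulrC divfK.
  by split; apply: (mulfI c0); apply: (mulfI ut0); rewrite mulrA [c * (k * _)]mulrA
    [c * k]mulrC [RHS]mulrA ukc mulrBl; lra.
have u0 := expR_gt0 L; have v0 := expR_gt0 (- L); have vu := expRVE L.
have u1 : expR L != 1.
  by apply: contra_neq L0 => u1; apply: expR_inj; rewrite u1 expR0.
have v1 : expR (- L) != 1.
  by apply: contra_neq u1 => v1; move: vu; rewrite v1 mul1r.
have T' : (a + d) ^+ 2 = expR (- L) + expR L + 2 by rewrite T; ring.
have uv : expR L * expR (- L) = 1 by rewrite mulrC.
have [[eA eB eC] [fA fB fC]] := translated_exp_curve mf eg trg.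
have [eB1 eA1] := kappa _ _ _ _ _ vu u0 T u1 eA eB eC.
have [fB1 fA1] := kappa _ _ _ _ _ uv v0 T' v1 fA fB fC.
have [[gA gB gC] [hA hB hC]] := translated_exp_curve mf eh trh.
have [gB1 gA1] := kappa _ _ _ _ _ vu u0 T u1 gA gB gC.
have [hB1 hA1] := kappa _ _ _ _ _ uv v0 T' v1 hA hB hC.
have [_ _ n] := exp_curve_norm eg; have [_ _ n'] := exp_curve_norm eh.
move: eB1 eA1 fB1 fA1 gB1 gA1 hB1 hA1.
set k1 := (_ / c); set k2 := ((a - _) / c) => eB1 eA1 fB1 fA1 gB1 gA1 hB1 hA1.
have pos xA xB xC yA yB yC (e : R -> H2 R) : exp_curve e xA xB xC yA yB yC ->
    xB = k1 * xC -> xA = k1 * xB -> yB = k2 * yC -> yA = k2 * yB ->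
    xA * yC + yA * xC - 2 * xB * yB = 1 ->
    [/\ 0 < xC, 0 < yC & xC * yC * (k1 - k2) ^+ 2 = 1].
  move=> ee -> -> -> -> ne.
  have nn : xC * yC * (k1 - k2) ^+ 2 = 1 by rewrite -ne; ring.
  have [_ _ c0e] := ee 0.
  have := cC_gt0 (e 0); rewrite c0e oppr0 expR0 !mulr1 => s0.
  have m0 : 0 < xC * yC.
    rewrite ltNge; apply/negP => m0.
    have : xC * yC * (k1 - k2) ^+ 2 <= 0 by rewrite mulr_le0_ge0 // sqr_ge0.
    by rewrite nn; lra.
  have x0 : 0 < xC.
    rewrite ltNge; apply/negP => x0.
    have y0 : 0 <= yC by lra.
    by have := mulr_le0_ge0 x0 y0; rewrite leNgt m0.
  by split=> //; rewrite -(pmulr_rgt0 _ x0).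
have [pC0 qC0 nn] := pos _ _ _ _ _ _ _ eg eB1 eA1 fB1 fA1 n.
have [pC'0 qC'0 nn'] := pos _ _ _ _ _ _ _ eh gB1 gA1 hB1 hA1 n'.
have k12 : (k1 - k2) ^+ 2 != 0.
  by apply: contra_eq_neq nn => ->; rewrite mulr0 eq_sym oner_eq0.
have pq : pC * qC = pC' * qC' by apply: (mulIf k12); rewrite nn nn'.
have r0 : 0 < pC' / pC by rewrite divr_gt0.
have s1 t : pC * expR (t + ln (pC' / pC)) = pC' * expR t.
  by rewrite expRD lnK //; field; rewrite gt_eqF.
have s2 t : qC * expR (- (t + ln (pC' / pC))) = qC' * expR (- t).
  have qE : qC = pC' * qC' / pC by rewrite -pq; field; rewrite gt_eqF.
  rewrite opprD expRD expRN [expR (- ln _)]expRN lnK // qE.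
  by field; rewrite !gt_eqF ?expR_gt0.
(* The shift rescales P by [pC' / pC] and Q by the inverse, as the equal products [pq] require. *)
exists (ln (pC' / pC)) => t; have [_ hB' hC'] := eh t.
have [_ gB' gC'] := eg (t + ln (pC' / pC)).
apply: coord_inj; first by rewrite hB' gB' eB1 fB1 gB1 hB1 -!mulrA s1 s2.
by rewrite hC' gC' s1 s2.
Qed.

End ExponentialCurves.

(** * Fractional linear maps as congruences of symmetric matrices *)

Section Moebius.
Variable R : realType.
Implicit Types (a b c d : R) (z w : H2 R).

Local Notation Re := complex.Re.
Local Notation Im := complex.Im.

Lemma mobius_denom_gt0 a b c d z : a * d - b * c = 1 ->
  0 < (c * Re z + d) ^+ 2 + (c * Im z) ^+ 2.
Proof.
move=> D; rewrite lt_neqAle addr_ge0 ?sqr_ge0 // andbT eq_sym.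
rewrite paddr_eq0 ?sqr_ge0 // !sqrf_eq0 mulf_eq0 (negbTE (Im_neq0 z)) orbF.
apply/negP => /andP[/eqP e /eqP c0]; move: e D; rewrite c0 mul0r add0r => ->.
by rewrite !mulr0 subrr => /eqP; rewrite eq_sym oner_eq0.
Qed.

Section Map.
Variables a b c d : R.
Hypothesis D : a * d - b * c = 1.

Let den z := (c * Re z + d) ^+ 2 + (c * Im z) ^+ 2.

Let mobius_Im_gt0 z : 0 < Im z / den z.
Proof. by rewrite divr_gt0 ?Im_gt0 // /den (mobius_denom_gt0 z D). Qed.

Definition mobius z : H2 R :=
  UHP (uhp_val := Complex
    (((a * Re z + b) * (c * Re z + d) + a * c * Im z ^+ 2) / den z) (Im z / den z))
    (mobius_Im_gt0 z).

Lemma mobiusP : mobius_coord mobius a b c d.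
Proof.
move=> z; have n0 : den z != 0 by rewrite gt_eqF // (mobius_denom_gt0 z D).
have i0 := Im_neq0 z.
rewrite /cA /cB /cC /=; move: n0 i0; rewrite /den.
move: (Re z) (Im z) => x y n0 i0; split.
(* Inserting [(a * d - b * c) ^+ 2], which is 1, in front of [y ^+ 2] makes the rest a formal
   identity. *)
- have -> : ((((a * x + b) * (c * x + d) + a * c * y ^+ 2) /
     ((c * x + d) ^+ 2 + (c * y) ^+ 2)) ^+ 2 +
    (y / ((c * x + d) ^+ 2 + (c * y) ^+ 2)) ^+ 2) /
    (y / ((c * x + d) ^+ 2 + (c * y) ^+ 2)) =
    (((a * x + b) * (c * x + d) + a * c * y ^+ 2) ^+ 2 +
      (a * d - b * c) ^+ 2 * y ^+ 2) /
      (y * ((c * x + d) ^+ 2 + (c * y) ^+ 2)) by rewrite D; field; rewrite n0 i0.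
  by field; rewrite n0 i0.
- by field; rewrite n0 i0.
- by field; rewrite n0 i0.
Qed.

Lemma mobius_complexE z : (mobius z : R[i]) =
  (real_complex R a * (z : R[i]) + real_complex R b) /
  (real_complex R c * (z : R[i]) + real_complex R d).
Proof.
have n0 : den z != 0 by rewrite gt_eqF // (mobius_denom_gt0 z D).
have dn0 : real_complex R c * (z : R[i]) + real_complex R d != 0.
  apply: contra_neq n0; rewrite /den; case: (uhp_val z) => x y /= [].
  move=> e1 e2; have -> : c * x + d = 0 by rewrite -e1; ring.
  by have -> : c * y = 0; rewrite ?expr0n ?addr0 // -e2; ring.
apply: (mulIf dn0); rewrite divfK //.
move: n0; rewrite /mobius /den /=; case: (uhp_val z) => x y /= n0.
apply/eqP; rewrite eq_complex /=; apply/andP; split; apply/eqP.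
  by rewrite -[y / _]mul1r -[in X in _ - X]D; field.
by rewrite -[y / _]mul1r -[in X in _ + X * _]D; field.
Qed.
End Map.

Lemma H2_val_inj z w : (z : R[i]) = w -> z = w.
Proof. by move=> e; apply: H2_inj; rewrite e. Qed.

Lemma mobius_coord_unique (f g : H2 R -> H2 R) a b c d :
  mobius_coord f a b c d -> mobius_coord g a b c d -> f =1 g.
Proof.
move=> hf hg z; have [_ fB fC] := hf z; have [_ gB gC] := hg z.
by apply: coord_inj; rewrite ?fB ?fC ?gB ?gC.
Qed.

Lemma mobius_coord_comp (f g : H2 R -> H2 R) a b c d a' b' c' d' :
  mobius_coord f a b c d -> mobius_coord g a' b' c' d' ->
  mobius_coord (f \o g) (a * a' + b * c') (a * b' + b * d')
    (c * a' + d * c') (c * b' + d * d').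
Proof.
move=> hf hg z /=; have [-> -> ->] := hf (g z); have [-> -> ->] := hg z.
by split; ring.
Qed.

Lemma mobius_coord_id : mobius_coord (@id (H2 R)) 1 0 0 1.
Proof. by move=> z; split; ring. Qed.

Lemma mobius_dist (f : H2 R -> H2 R) a b c d : a * d - b * c = 1 ->
  mobius_coord f a b c d -> forall z w, hyp_dist (f z) (f w) = hyp_dist z w.
Proof.
move=> D hf z w; rewrite !hyp_distE; congr arcosh; rewrite /bil.
have [-> -> ->] := hf z; have [-> -> ->] := hf w.
rewrite -[RHS](mul1r) -[X in _ = X * _](expr1n R 2) -[X in _ = X ^+ 2 * _]D.
by field.
Qed.

Lemma mobiusK a b c d (D : a * d - b * c = 1) (D' : d * a - (- b) * (- c) = 1) :
  cancel (mobius D) (mobius D').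
Proof.
apply: (@mobius_coord_unique _ id 1 0 0 1); last exact: mobius_coord_id.
have := mobius_coord_comp (mobiusP D') (mobiusP D).
have -> : d * a + - b * c = 1 by lra.
have -> : d * b + - b * d = 0 by ring.
have -> : - c * a + a * c = 0 by ring.
by have -> : - c * b + a * d = 1 by lra.
Qed.

Lemma mobius_isom_exists a b c d : a * d - b * c = 1 ->
  exists f : isom R, mobius_coord f a b c d.
Proof.
move=> D; have D' : d * a - (- b) * (- c) = 1 by lra.
have K : cancel (mobius D') (mobius D).
  have D'' : a * d - (- (- b)) * (- (- c)) = 1 by rewrite !opprK.
  move=> z; rewrite -[RHS](mobiusK D' D'' z).
  by apply: (@mobius_coord_unique _ _ a b c d); [exact: mobiusP|];
    have := mobiusP D''; move: (mobius D'') => g; rewrite !opprK.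
by exists (Isom (mobiusK D D') K (mobius_dist D (mobiusP D))); exact: mobiusP.
Qed.

(** Replaces the complex formula by the matrix action, the form in which integrality of the entries
    is exploited below. *)
Lemma modular_groupP (f : isom R) : modular_group f <->
  exists a b c d : int, a * d - b * c = 1 /\
    mobius_coord f a%:~R b%:~R c%:~R d%:~R.
Proof.
have E (a b c d : int) (D : a * d - b * c = 1) :
    {D' : a%:~R * d%:~R - b%:~R * c%:~R = 1 :> R | forall z,
    (mobius D' z : R[i]) =
    (a%:~R * (z : R[i]) + b%:~R) / (c%:~R * (z : R[i]) + d%:~R)}.
  have D' : a%:~R * d%:~R - b%:~R * c%:~R = 1 :> R.
    by rewrite -!intrM -intrB D.
  by exists D' => z; rewrite mobius_complexE !rmorph_int.
split=> -[a [b [c [d [D fE]]]]]; exists a, b, c, d; split=> //.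
  have [D' DE] := E _ _ _ _ D; have := mobiusP D'.
  by have -> : mobius D' = f by apply/funext => z; apply: H2_val_inj; rewrite DE fE.
have [D' DE] := E _ _ _ _ D => z.
by rewrite -DE; congr uhp_val; exact: mobius_coord_unique fE (mobiusP D') z.
Qed.

Lemma mobius_coord_expg (f : isom R) a b c d (n : nat) :
  mobius_coord (f ^+ n)%g a b c d -> 
  forall a' b' c' d', mobius_coord f a' b' c' d' ->
  mobius_coord (f ^+ n.+1)%g (a' * a + b' * c) (a' * b + b' * d)
    (c' * a + d' * c) (c' * b + d' * d).
Proof. by move=> hn a' b' c' d' hf; rewrite expgS; exact: mobius_coord_comp. Qed.

Lemma mobius_upper_expg (f : isom R) b (n : nat) :
  mobius_coord f 1 b 0 1 -> mobius_coord (f ^+ n)%g 1 (n%:R * b) 0 1.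
Proof.
move=> hf; elim: n => [|n IHn]; first by rewrite mul0r; exact: mobius_coord_id.
have := mobius_coord_expg IHn hf.
by rewrite !(mul1r, mulr1, mul0r, mulr0, addr0, add0r) -[n.+1%:R]natr1 mulrDl mul1r.
Qed.

Lemma mobius_lower_expg (f : isom R) c (n : nat) :
  mobius_coord f 1 0 c 1 -> mobius_coord (f ^+ n)%g 1 0 (n%:R * c) 1.
Proof.
move=> hf; elim: n => [|n IHn]; first by rewrite mul0r; exact: mobius_coord_id.
have := mobius_coord_expg IHn hf.
by rewrite !(mul1r, mulr1, mul0r, mulr0, addr0, add0r) -[n.+1%:R]nat1r mulrDl mul1r.
Qed.

End Moebius.

(** * Explicit geodesics with two real endpoints *)

Section Semicircle.
Variable R : realType.
Implicit Types (m p t : R).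

Local Notation Re := complex.Re.
Local Notation Im := complex.Im.

Lemma semicircle_Im_gt0 m p t : m < p -> 0 < (p - m) / (expR t + expR (- t)).
Proof. by move=> mp; rewrite divr_gt0 ?subr_gt0 // addr_gt0 ?expR_gt0. Qed.

(** The unit-speed half-circle running from [m] to [p]. Its summit, at [t] = 0, has height (p - m) /
    2, and the heights at [t] and [- t] agree. *)
Definition semicircle m p (mp : m < p) t : H2 R :=
  UHP (uhp_val := Complex ((p * expR t + m * expR (- t)) / (expR t + expR (- t)))
    ((p - m) / (expR t + expR (- t)))) (semicircle_Im_gt0 t mp).

Lemma semicircle_exp_curve m p (mp : m < p) :
  exp_curve (semicircle mp) (p ^+ 2 / (p - m)) (p / (p - m)) (p - m)^-1
    (m ^+ 2 / (p - m)) (m / (p - m)) (p - m)^-1.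
Proof.
move=> t; rewrite /cA /cB /cC /=.
have d0 : p - m != 0 by rewrite subr_eq0 gt_eqF.
have uv := expRVE t; have u0 := expR_gt0 t; have v0 := expR_gt0 (- t).
move: (expR t) (expR (- t)) uv u0 v0 => u v uv u0 v0.
have s0 : u + v != 0 by rewrite gt_eqF ?addr_gt0.
split; last 2 first.
- by field; rewrite d0.
- by field; rewrite d0.
have -> : (((p * u + m * v) / (u + v)) ^+ 2 + ((p - m) / (u + v)) ^+ 2) /
    ((p - m) / (u + v)) =
    ((p * u + m * v) ^+ 2 + (p - m) ^+ 2 * (v * u)) / ((u + v) * (p - m)).
  by rewrite uv; field; rewrite d0.
by field; rewrite d0.
Qed.

Lemma semicircle_geodesic m p (mp : m < p) : geodesic (semicircle mp).
Proof.
move=> t; exists 1 => // s s' _ _; apply/hyp_distP; rewrite /bil /ch opprB !expRD.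
have [-> -> ->] := semicircle_exp_curve mp s.
have [-> -> ->] := semicircle_exp_curve mp s'.
by field; rewrite subr_eq0 gt_eqF.
Qed.

(** The premises make (p, 1) and (m, 1) eigenvectors of the matrix for e^L and e^-L. The null
    vectors of the curve are quadratic in these, so the eigenvalues get squared and the translation
    length is [2 * L]. *)
Lemma semicircle_translate m p (mp : m < p) (f : H2 R -> H2 R) a b c d L :
  mobius_coord f a b c d -> c * p + d = expR L -> a * p + b = expR L * p ->
  c * m + d = expR (- L) -> a * m + b = expR (- L) * m ->
  forall t, semicircle mp (t + 2 * L) = f (semicircle mp t).
Proof.
move=> mf e1 e2 e3 e4 t; have [_ fB fC] := mf (semicircle mp t).
have [_ gB gC] := semicircle_exp_curve mp (t + 2 * L).
have [hA hB hC] := semicircle_exp_curve mp t.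
have d0 : p - m != 0 by rewrite subr_eq0 gt_eqF.
have eL : expR (2 * L) = expR L * expR L by rewrite -expRD; congr expR; ring.
have eL' : expR (- (2 * L)) = expR (- L) * expR (- L).
  by rewrite -expRD; congr expR; ring.
apply: coord_inj.
- rewrite fB gB hA hB hC opprD !expRD eL eL'.
  have -> : p / (p - m) * (expR t * (expR L * expR L)) +
    m / (p - m) * (expR (- t) * (expR (- L) * expR (- L))) =
    (expR L * p * expR L / (p - m)) * expR t +
    (expR (- L) * m * expR (- L) / (p - m)) * expR (- t) by field.
  by rewrite -e2 -e4 -e1 -e3; field.
- rewrite fC gC hA hB hC opprD !expRD eL eL' -e1 -e3.
  by field.
Qed.

End Semicircle.

(** * Subgroups, conjugation and finite index *)

Section Subgroups.
Variable G : groupType.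
Implicit Types (A B : set G) (x y g : G).

Lemma subgroupM A x y : is_subgroup A -> A x -> A y -> A (x * y)%g.
Proof.
move=> [A1 AV] Ax Ay; rewrite -[y]invgK; apply: (AV) => //.
by rewrite -[(y^-1)%g]mul1g; exact: AV.
Qed.

Lemma subgroupV A x : is_subgroup A -> A x -> A (x^-1)%g.
Proof. by move=> [A1 AV] Ax; rewrite -[(x^-1)%g]mul1g; exact: AV. Qed.

Lemma subgroupX A x n : is_subgroup A -> A x -> A (x ^+ n)%g.
Proof.
move=> sA Ax; elim: n => [|n IHn]; first by rewrite expg0; case: sA.
by rewrite expgS; exact: subgroupM.
Qed.

Lemma subgroup_conj A g : is_subgroup A ->
  is_subgroup [set (g * f * g^-1)%g | f in A].
Proof.
move=> [A1 AV]; split; first by exists 1%g => //; rewrite mulg1 mulgV.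
move=> _ _ [x Ax <-] [y Ay <-]; exists (x * y^-1)%g; first exact: AV.
by rewrite !invgM invgK !mulgA mulgVK.
Qed.

Lemma conj_expg g x n : ((g * x * g^-1) ^+ n = g * x ^+ n * g^-1)%g.
Proof.
by have := conjXg x (g^-1)%g n; rewrite !conjgE !invgK !mulgA => ->.
Qed.

(** Pigeonhole: with m cosets, two of the powers x^0, ..., x^m share one, so x^i lies in [B] for
    some 0 < i <= m. The exponent m! is a multiple of every such i, hence uniform in [x]. *)
Lemma finite_index_expg B A : is_subgroup B -> finite_index B A ->
  exists2 N : nat, (0 < N)%N &
    forall x, (forall n, A (x ^+ n)%g) -> B (x ^+ N)%g.
Proof.
move=> sB [_ /finite_seqP[s sE]]; exists (size s)`!; first exact: fact_gt0.
move=> x Ax.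
pose coset n := [set (x ^+ n * h)%g | h in B].
have : ~~ uniq [seq coset n | n <- iota 0 (size s).+1].
  apply/negP => us.
  have /(uniq_leq_size us) : {subset [seq coset n | n <- iota 0 (size s).+1] <= s}.
    move=> _ /mapP[n _ ->]; suff : [set` s] (coset n) by [].
    by rewrite -sE; exists (x ^+ n)%g.
  by rewrite size_map size_iota ltnn.
move=> /(uniqPn set0)[i [j [ij]]]; rewrite size_map size_iota => js.
have is_ : (i < (size s).+1)%N by exact: ltn_trans ij js.
rewrite !(nth_map 0%N) ?size_iota // !nth_iota // !add0n => ije.
have : coset j (x ^+ j)%g by exists 1%g; [case: sB | rewrite mulg1].
rewrite -ije => -[h Bh xh].
have hE : h = (x ^+ (j - i))%g.
  by apply: (mulgI (x ^+ i)%g); rewrite xh -expgnDr subnKC // ltnW.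
have /dvdnP[k ->] : (j - i %| (size s)`!)%N.
  by rewrite dvdn_fact // subn_gt0 ij (leq_trans (leq_subr _ _)).
by rewrite mulnC expgnA -hE; exact: subgroupX.
Qed.

End Subgroups.

(** * Lucas sequences and their periodicity modulo q *)

Section LucasSequence.
Variable t : int.

(** A state holds two consecutive terms, the later one first. The ring is a parameter so that the
    recurrence can run both over the integers and modulo q. *)
Definition lucas_step (S : pzRingType) (x : S * S) : S * S :=
  (t%:~R * x.1 - x.2, x.1).

Lemma lucas_step_inj (S : pzRingType) : injective (@lucas_step S).
Proof.
move=> [x y] [x' y']; rewrite /lucas_step /= => -[e xx']; rewrite xx' in e *.
by move/addrI: e => /oppr_inj ->.
Qed.

Definition lucas (n : nat) : int :=
  (iter n (@lucas_step int) (t, 2)).2.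

Lemma lucas_power (S : comPzRingType) (u v : S) : u * v = 1 -> u + v = t%:~R ->
  forall n, (lucas n)%:~R = u ^+ n + v ^+ n.
Proof.
move=> uv tE n; suff [] :
    ((iter n (@lucas_step int) (t, 2)).1)%:~R = u ^+ n.+1 + v ^+ n.+1
    /\ (lucas n)%:~R = u ^+ n + v ^+ n by [].
elim: n => [|n [IH1 IH2]]; first by rewrite /lucas /= !expr1 !expr0 tE.
rewrite /lucas iterS /lucas_step /= -/(lucas n); split => //.
rewrite intrB intrM IH1 intz IH2 -tE.
rewrite !(exprS _ n.+1) !(exprS _ n).
have -> : u * (u * u ^+ n) + v * (v * v ^+ n) = (u + v) * (u * u ^+ n + v * v ^+ n)
   - (u * v) * (u ^+ n + v ^+ n) by ring.
by rewrite uv mul1r.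
Qed.

(** The step is an injection of a finite set modulo q, so the orbit of the initial state is a cycle;
    each return brings back the term of index 0, which is 2. *)
Lemma lucas_periodic (q : nat) : (1 < q)%N ->
  exists2 n : nat, (0 < n)%N &
    forall j, exists r : int, lucas (n * j) = 2 + q%:Z * r.
Proof.
move=> q1; pose F := @lucas_step 'Z_q; pose x0 : 'Z_q * 'Z_q := (t%:~R, 2%:~R).
have Finj : injective F := @lucas_step_inj _.
have FE n : iter n F x0 = ((iter n (@lucas_step int) (t, 2)).1%:~R, (lucas n)%:~R).
  elim: n => [|n IHn]; first by [].
  by rewrite iterS IHn /F /lucas iterS /lucas_step /= intrB intrM intz.
exists (fingraph.order F x0) => [|j]; first exact: fingraph.order_gt0.
have e : iter (fingraph.order F x0 * j) F x0 = x0.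
  elim: j => [|j IHj]; first by rewrite muln0.
  by rewrite mulnS iterD IHj (fingraph.iter_order Finj).
have := FE (fingraph.order F x0 * j)%N; rewrite e => -[_].
set s := lucas _ => sE.
have s0 : (s - 2)%:~R = 0 :> 'Z_q by rewrite intrB -sE subrr.
have : (q %| `|s - 2|)%N.
  have a0 : (`|s - 2|%N)%:R = 0 :> 'Z_q.
    have : ((`|s - 2|%N)%:Z)%:~R = 0 :> 'Z_q.
      by rewrite abszEsg intrM s0 mulr0.
    by [].
  have := congr1 val a0; rewrite /= val_Zp_nat // => /eqP; rewrite /dvdn => /eqP.
  by move=> ->.
move=> /dvdnP[k kE]; exists (sgz (s - 2) * k%:Z).
have : s - 2 = sgz (s - 2) * `|s - 2|%N%:Z by exact: intEsg.
move: (sgz _) => e'; rewrite kE PoszM => h.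
by rewrite -[LHS](subrK 2) h; ring.
Qed.

End LucasSequence.

Lemma int_mul_eq1 (a d : int) : a * d = 1 -> d = a /\ d ^+ 2 = 1.
Proof.
move=> ad; have : `|(a * d)%R|%N == 1%N by rewrite ad.
rewrite abszM muln_eq1 => /andP[/eqP a1 /eqP d1].
have [dE|dE] : d = 1 \/ d = -1 by lia.
  by rewrite dE in ad *; split; [lia | rewrite expr1n].
by rewrite dE in ad *; split; [lia | rewrite sqrrN expr1n].
Qed.

(** * Height estimates, the axis of the word, and exclusion of roots *)

Section PrimitiveWord.
Variable R : realType.

Local Notation Re := complex.Re.
Local Notation Im := complex.Im.

Lemma geodesic_isom (f : isom R) (g : R -> H2 R) :
  geodesic g -> geodesic (f \o g).
Proof.
move=> gg t; have [e e0 he] := gg t.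
by exists e => // *; rewrite isom_dist; exact: he.
Qed.

Lemma iterate_translation (f : isom R) (g : R -> H2 R) (l : R) (n : nat) :
  (forall t, g (t + l) = f (g t)) ->
  forall t, g (t + n%:R * l) = (f ^+ n)%g (g t).
Proof.
move=> gf; elim: n => [|n IHn] t; first by rewrite mul0r addr0.
rewrite expgS; have -> : (f * f ^+ n)%g (g t) = f ((f ^+ n)%g (g t)) by [].
by rewrite -IHn -gf -natr1; congr g; ring.
Qed.

Lemma ler_ch (x y : R) : 0 <= x -> x <= y -> ch x <= ch y.
Proof.
move=> x0 xy; rewrite /ch ler_pM2r ?invr_gt0 //.
have := expRVE x; have := expRVE y; have v0 := expR_gt0 (- y).
have u0 := expR_gt0 (- x).
have : expR x <= expR y by rewrite ler_expR.
have : 1 <= expR x by rewrite -expR0 ler_expR.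
have v1 : expR (- y) <= 1 by rewrite -expR0 ler_expR oppr_le0 (le_trans x0).
move: (expR x) (expR y) (expR (- x)) (expR (- y)) u0 v0 v1.
move=> a b a' b' u0 v0 v1 a1 ab bb aa.
rewrite -subr_ge0.
have -> : b + b' - (a + a') = (b - a) * (1 - a' * b') + (1 - a' * a) * b' -
  (1 - b' * b) * a' by ring.
rewrite aa bb !subrr !mul0r addr0 subr0 mulr_ge0 ?subr_ge0 //.
by rewrite -aa ler_wpM2l ?(ltW u0) //; lra.
Qed.

(** A distance is at least the difference of the logarithms of the heights, and e^d <= 2 cosh d. *)
Lemma bil_vertical_ge (z w : H2 R) : Im z * cC w <= 2 * bil z w.
Proof.
rewrite bilE /cC; have z0 := Im_gt0 z; have w0 := Im_gt0 w.
have -> : 2 * (1 + ((Re z - Re w) ^+ 2 + (Im z - Im w) ^+ 2) / (2 * Im z * Im w)) =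
  Im z / Im w + ((Re z - Re w) ^+ 2 + Im w ^+ 2) / (Im z * Im w).
  by field; rewrite !gt_eqF.
by rewrite lerDl divr_ge0 ?addr_ge0 ?sqr_ge0 // mulr_ge0 // ltW.
Qed.

(** The map is the horizontal shift by [e * b], whose displacement depends on the height alone. *)
Lemma bil_upper (f : H2 R -> H2 R) (e b : R) (z : H2 R) : e ^+ 2 = 1 ->
  mobius_coord f e b 0 e -> bil z (f z) = 1 + (b * cC z) ^+ 2 / 2.
Proof.
move=> e1 mf; rewrite /bil; have [-> -> ->] := mf z.
rewrite [LHS](_ : _ =
  e ^+ 2 * (cA z * cC z - cB z ^+ 2) + (b * cC z) ^+ 2 / 2); last by field.
by rewrite coord_det e1 mul1r.
Qed.

(** A map with |c| >= 1 sends height y to height at most 1 / y, so it moves points high in the cusp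
    very far. *)
Lemma bil_lower_ge (f : H2 R -> H2 R) (a b c d : R) (z : H2 R) : 1 <= c ^+ 2 ->
  mobius_coord f a b c d -> Im z ^+ 2 <= 2 * bil z (f z).
Proof.
move=> c1 mf; apply: le_trans (bil_vertical_ge _ _).
have [_ _ ->] := mf z; have y0 := Im_gt0 z.
have -> : Im z * (c ^+ 2 * cA z + 2 * c * d * cB z + d ^+ 2 * cC z) =
    (c * Re z + d) ^+ 2 + c ^+ 2 * Im z ^+ 2.
  by rewrite /cA /cB /cC; field; rewrite gt_eqF.
have := sqr_ge0 (c * Re z + d); have : 0 <= (c ^+ 2 - 1) * Im z ^+ 2.
  by rewrite mulr_ge0 ?sqr_ge0 // subr_ge0.
by lra.
Qed.

(** Comparing the points i and 2i would give 3 c^2 = 0: scaling all heights by one factor forces the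
    point at infinity to be fixed. *)
Lemma not_scaling_height (f : H2 R -> H2 R) (a b c d k : R) : c != 0 ->
  mobius_coord f a b c d -> ~ forall z, cC (f z) = k * cC z.
Proof.
move=> c0 mf h.
have i1 : 0 < complex.Im (Complex 0 (1 : R)) by rewrite /=.
have i2 : 0 < complex.Im (Complex 0 (2 : R)) by rewrite /=.
have := h (UHP i1); have := h (UHP i2).
have [_ _ ->] := mf (UHP i1); have [_ _ ->] := mf (UHP i2).
rewrite /cA /cB /cC /= => e2 e1.
have : c ^+ 2 = 0 by lra.
by move/eqP; rewrite sqrf_eq0 (negbTE c0).
Qed.

(** The matrix [[1, b], [c, c b + 1]] of V^c T^b has trace e^L + e^-L, so its eigenvalues are e^L
    and e^-L, and the endpoints solve c x + c b + 1 = e^L or e^-L. The diameter is recorded for the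
    height estimate. *)
Lemma word_axis (f : H2 R -> H2 R) (b c L : R) :
  0 < c -> 0 < L -> c * b = expR L + expR (- L) - 2 ->
  mobius_coord f 1 b c (c * b + 1) ->
  exists (m p : R) (mp : m < p), c * (p - m) = expR L - expR (- L) /\
    forall t, semicircle mp (t + 2 * L) = f (semicircle mp t).
Proof.
move=> c0 L0 cb mf.
have lm : expR (- L) < expR L by rewrite ltr_expR; lra.
have mu1 : expR (- L) * expR L = 1 := expRVE L.
pose p := (1 - expR (- L)) / c; pose m := (1 - expR L) / c.
have cp : c * p = 1 - expR (- L) by rewrite mulrC divfK // gt_eqF.
have cm : c * m = 1 - expR L by rewrite mulrC divfK // gt_eqF.
have mp : m < p by rewrite ltr_pM2r ?invr_gt0 //; lra.
exists m, p, mp; split; first by rewrite mulrBr cp cm; ring.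
have cI := mulfI (lt0r_neq0 c0).
apply: (semicircle_translate _ mf).
- by rewrite addrA cp cb; lra.
- apply: cI; rewrite mul1r mulrDr cb [RHS]mulrCA cp mulrBr.
  by rewrite [_ * expR (- L)]mulrC mu1; lra.
- by rewrite addrA cm cb; lra.
- by apply: cI; rewrite mul1r mulrDr cb [RHS]mulrCA cm mulrBr mu1; lra.
Qed.

(* The axis of the word V^c T^b makes one excursion of height about b / 2 into
   the cusp and its period is essentially that excursion; a root delta of the
   word would shift the axis by at most half its period, so some z and delta z
   would both lie high in the cusp, where the width of the cusp and that of
   its image under delta are incompatible. *)
Lemma word_not_power (f d P S : isom R) (b c L s : R) (n : nat) :
  0 < c -> 1 <= s -> 0 < L -> c * b = expR L + expR (- L) - 2 ->
  c * (s + 2) <= expR (L / 2) - expR (- (L / 2)) ->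
  mobius_coord f 1 b c (c * b + 1) -> mobius_coord S 1 s 0 1 ->
  modular_group P -> (P * d = d * S)%g -> (2 <= n)%N -> f <> (d ^+ n)%g.
Proof.
move=> c0 s1 L0 cb big mf mS /modular_groupP[a' [b' [c' [d' [D' mP]]]]] Pd n2 fE.
have D : 1 * (c * b + 1) - b * c = 1 by ring.
have [m [p [mp [cpm gf]]]] := word_axis c0 L0 cb mf.
move: gf; set g := semicircle mp => gf.
(* As a power of [d], [f] commutes with [d]; hence [d \o g] is again an axis of [f], that is, [g]
   shifted by some [tau]. *)
have dg : geodesic (d \o g) := geodesic_isom d (semicircle_geodesic mp).
have comm : (d * f = f * d)%g by rewrite fE -expgS expgSr.
have dgf t : (d \o g) (t + 2 * L) = f ((d \o g) t).
  by rewrite /= gf; have := congr1 (fun k : isom R => k (g t)) comm.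
have c00 : c != 0 by rewrite gt_eqF.
have L00 : 2 * L != 0 by rewrite gt_eqF // mulr_gt0.
have [tau tauE] := axis_unique D c00 L00 mf (semicircle_geodesic mp) dg gf dgf.
have iter_d k t : (d ^+ k)%g (g t) = g (t + k%:R * tau).
  elim: k t => [|k IHk] t; first by rewrite mul0r addr0.
  rewrite expgSr; have -> : (d ^+ k * d)%g (g t) = (d ^+ k)%g (d (g t)) by [].
  have -> : d (g t) = g (t + tau) by exact: tauE.
  by rewrite IHk -natr1; congr g; ring.
have pm0 : 0 < p - m by rewrite subr_gt0.
(* Along the axis [f] shifts the parameter by [2 * L] and [d ^+ n] by [n%:R * tau]; the coefficients
   of e^t in [cC] identify the two. *)
have ntau : n%:R * tau = 2 * L.
  have [e _] : (p - m)^-1 * expR (n%:R * tau) = (p - m)^-1 * expR (2 * L) /\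
      (p - m)^-1 * expR (- (n%:R * tau)) = (p - m)^-1 * expR (- (2 * L)).
    apply: expR_pair_eq => t.
    have := semicircle_exp_curve mp (t + n%:R * tau).
    have := semicircle_exp_curve mp (t + 2 * L).
    rewrite -/(g _) -/(g _) gf {1 2 3}fE iter_d => -[_ _ ->] [_ _].
    by rewrite !opprD !expRD -!mulrA ![expR t * _]mulrC ![expR (- t) * _]mulrC.
  apply: expR_inj; apply: mulfI e; by rewrite invr_neq0 // gt_eqF.
have n2R : 2 <= n%:R :> R by rewrite (ler_nat R 2 n).
have tau0 : 0 < tau.
  by rewrite -(pmulr_rgt0 _ (_ : 0 < n%:R :> R)) ?ntau ?mulr_gt0 //; lra.
have tauL : tau <= L.
  by have : 2 * tau <= n%:R * tau; [rewrite ler_pM2r | rewrite ntau; lra].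
(* Centred at the summit, [z] and [d z] have equal height. *)
pose z := g (- (tau / 2)).
have dz : d z = g (tau / 2).
  by rewrite /z; have /= -> := tauE (- (tau / 2)); congr g; lra.
have yE : Im (d z) = Im z by rewrite dz /z /= opprK [expR (- _) + _]addrC.
(* Since [tau <= L], the height is at least (p - m) / (2 ch (L / 2)), which equals (e^(L/2) -
   e^(-L/2)) / c. *)
have y2 : s + 2 <= Im z.
  rewrite /z /= opprK [expR (- _) + _]addrC.
  have -> : expR (tau / 2) + expR (- (tau / 2)) = 2 * ch (tau / 2).
    by rewrite /ch; field.
  have chl : ch (tau / 2) <= ch (L / 2) by apply: ler_ch; lra.
  have ch0 : 0 < ch (tau / 2) by apply: lt_le_trans (ch_ge1 _).
  rewrite ler_pdivlMr; last by rewrite mulr_gt0.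
  rewrite -(ler_pM2l c0) cpm.
  have -> : expR L - expR (- L) =
      (expR (L / 2) - expR (- (L / 2))) * (2 * ch (L / 2)).
    rewrite /ch [2 * _]mulrC divfK // -subr_sqr !expr2 -!expRD.
    by rewrite -opprD -!splitr; ring.
  rewrite [c * (_ * _)]mulrA; apply: ler_pM => //; last by lra.
    by rewrite mulr_ge0 ?(ltW c0) //; lra.
  by rewrite mulr_ge0 ?(ltW ch0).
(* [P] moves [d w] exactly as far as [S] moves [w], because [P * d = d * S]. *)
have disp w : bil (d w) (P (d w)) = 1 + (s * cC w) ^+ 2 / 2.
  rewrite -(bil_upper _ (expr1n _ 2) mS) -[RHS](bil_isom d).
  by have /= -> := congr1 (fun k : isom R => k w) Pd.
(* If [P] does not fix infinity, it moves the high point [d z] far, whereas [disp] bounds [bil]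
   there by 3/2; with height at least 3 this is absurd. *)
have [c'0|c'0] := eqVneq c' 0; last first.
  have c'1 : 1 <= c'%:~R ^+ 2 :> R.
    by rewrite -rmorphXn /= -[1]/(1%:~R) ler_int -gtz0_ge1 lt0r sqrf_eq0 c'0 sqr_ge0.
  have := bil_lower_ge (d z) c'1 mP; rewrite yE disp.
  have y0 := Im_gt0 z; have : s * cC z <= 1.
    by rewrite /cC ler_pdivrMr // mul1r; lra.
  have : 0 <= s * cC z by rewrite mulr_ge0 // ?ltW ?cC_gt0 //; lra.
  by move: (s * cC z) (Im z) y2 => q y y2 q0 q1; nra.
(* Otherwise [P] is a horizontal shift. Equal displacements at every point then make [d], and so
   [f], scale all heights by a constant, contrary to [c != 0]. *)
have [da d1] : d' = a' /\ (d' ^+ 2 = 1).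
  by apply: int_mul_eq1; move: D'; rewrite c'0 mulr0 subr0.
have e1 : d'%:~R ^+ 2 = 1 :> R by rewrite -rmorphXn /= d1.
rewrite c'0 -da in mP.
pose k := `|b'%:~R : R|.
have hk w : s * cC w = k * cC (d w).
  have := disp w; rewrite (bil_upper _ e1 mP) => /addrI.
  have i2 : (2^-1 : R) != 0 by rewrite invr_neq0.
  move=> /(mulIf i2)/eqP; rewrite eqf_sqr.
  have w0 := cC_gt0 w; have dw0 := cC_gt0 (d w).
  have sw : 0 < s * cC w by rewrite mulr_gt0 //; lra.
  move=> h; rewrite -[LHS]gtr0_norm // /k -[cC (d w) in RHS]gtr0_norm // -normrM.
  by case/orP: h => /eqP -> //; rewrite normrN.
have k0 : k != 0.
  apply/eqP => k0; have := hk z; rewrite k0 mul0r => /eqP.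
  by rewrite gt_eqF // mulr_gt0 ?cC_gt0 //; lra.
have iterC j w : cC ((d ^+ j)%g w) = (s / k) ^+ j * cC w.
  elim: j => [|j IHj]; first by rewrite mul1r.
  rewrite expgS; have -> : (d * d ^+ j)%g w = d ((d ^+ j)%g w) by [].
  apply: (mulfI k0); rewrite -hk IHj exprS.
  by field.
apply: (not_scaling_height c00 mf (k := (s / k) ^+ n)) => w.
by rewrite fE iterC.
Qed.

End PrimitiveWord.

(** * Primitive words in a group sharing a finite-index subgroup with PSL(2,Z) *)

Section Commensurable.
Variable R : realType.

Lemma modular_translations : exists T V : isom R,
  [/\ mobius_coord T 1 1 0 1, mobius_coord V 1 0 1 1,
      forall n, modular_group (T ^+ n)%g & forall n, modular_group (V ^+ n)%g].
Proof.
have [|T hT] := @mobius_isom_exists R 1 1 0 1; first by ring.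
have [|V hV] := @mobius_isom_exists R 1 0 1 1; first by ring.
exists T, V; split=> // n; apply/modular_groupP.
  exists 1, n%:Z, 0, 1; split; first by ring.
  by have := mobius_upper_expg n hT; rewrite mulr1.
exists 1, 0, n%:Z, 1; split; first by ring.
by have := mobius_lower_expg n hV; rewrite mulr1.
Qed.

Lemma primitive_translations (G D : set (isom R)) (E : nat) (T V : isom R) :
  is_subgroup G -> is_subgroup D -> D `<=` G -> D `<=` @modular_group R ->
  (0 < E)%N -> (forall f, G f -> D (f ^+ E)%g) ->
  mobius_coord T 1 1 0 1 -> mobius_coord V 1 0 1 1 ->
  D (T ^+ E)%g -> D (V ^+ E)%g ->
  forall (f : isom R) (g : R -> H2 R) (l : R), G f -> 0 < l -> geodesic g ->
  (forall t, g (t + l) = f (g t)) ->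
  exists n0 j0 : nat, (0 < n0)%N /\ forall j, (j0 <= j)%N ->
    exists (f' : isom R) (g' : R -> H2 R),
      [/\ primitive G f', geodesic g' &
          forall t, g' (t + (n0 * j)%:R * l) = f' (g' t)].
Proof.
move=> sG sD DG DP E0 GE mT mV DT DV f g l Gf l0 gg gf.
have ER : 1 <= E%:R :> R by rewrite (ler_nat R 1 E).
pose theta := E%:R * l.
have th0 : 0 < theta by rewrite mulr_gt0 //; lra.
have [a [b [c [d [D1 mf]]]]] := (modular_groupP (f ^+ E)%g).1 (DP _ (GE _ Gf)).
have DR : a%:~R * d%:~R - b%:~R * c%:~R = 1 :> R by rewrite -!intrM -intrB D1.
have := translation_trace DR (lt0r_neq0 th0) mf gg (iterate_translation E gf).
rewrite -/theta => tr.
(* The trace of the square of the matrix of [f ^+ E], unaffected by the sign ambiguity of that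
   matrix. *)
pose t : int := (a + d) ^+ 2 - 2.
have tE : expR theta + expR (- theta) = t%:~R.
  by rewrite /t intrB rmorphXn /= intrD tr; ring.
have uv : expR theta * expR (- theta) = 1 by rewrite mulrC expRVE.
(* The factor 2 keeps the modulus above 1 even when [E] is 1. *)
have q1 : (1 < 2 * (E * E))%N by nia.
have [n n0 per] := lucas_periodic t q1.
(* This is [c * (s + 2)] of [word_not_power] with c = E and s = E^2. The threshold [j0] yields
   [X <= L / 2], and its successor makes every admissible [j] positive. *)
pose X : R := E%:R * ((E * E)%:R + 2).
pose j0 := (Num.bound (2 * X / l)).+1.
(* A word of trace 2 cosh L translates by 2 L, where L = n j E l. *)
exists (2 * (n * E))%N, j0; split; first by rewrite !muln_gt0 n0 E0.
move=> j jj0.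
pose L := (n * j)%:R * theta.
have j1 : (0 < j)%N by exact: leq_ltn_trans jj0.
have L0 : 0 < L by rewrite mulr_gt0 // ltr0n muln_gt0 n0.
have [r rE] := per j.
have LE : expR L + expR (- L) - 2 = (2 * (E * E))%:R * r%:~R.
  have := lucas_power uv tE (n * j); rewrite rE intrD intrM -!expRM_natl mulrN.
  by rewrite -/L => <-; rewrite addrC addKr.
have EE0 : 0 < (2 * (E * E))%:R :> R by rewrite ltr0n muln_gt0 /= muln_gt0 E0.
have r0 : 0 <= r.
  rewrite -(ler_int R) -(pmulr_rge0 _ EE0) -LE.
  by have := ch_ge1 L; rewrite /ch; lra.
have [r' r'E] : exists r' : nat, r = r' by exists `|r|%N; rewrite gez0_abs.
(* The exponent makes b = 2 r E, so that E b = 2 E^2 r = 2 cosh L - 2. *)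
pose w := ((V ^+ E) * ((T ^+ E) ^+ (2 * r')))%g.
have Dw : D w by apply: subgroupM => //; exact: subgroupX.
pose bR : R := (2 * r')%:R * E%:R.
have cb : E%:R * bR = expR L + expR (- L) - 2.
  by rewrite LE r'E /bR !natrM; ring.
have mw : mobius_coord w 1 bR E%:R (E%:R * bR + 1).
  have := mobius_coord_comp (mobius_lower_expg E mV)
    (mobius_upper_expg (2 * r') (mobius_upper_expg E mT)).
  by rewrite !(mul1r, mulr1, mul0r, mulr0, addr0, add0r).
have mS : mobius_coord ((T ^+ E) ^+ E)%g 1 (E * E)%:R 0 1.
  by have := mobius_upper_expg E (mobius_upper_expg E mT); rewrite mulr1 -natrM.
have sE : 1 <= (E * E)%:R :> R by rewrite (ler_nat R 1) muln_gt0 E0.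
have big : X <= expR (L / 2) - expR (- (L / 2)).
  have X0 : 0 <= X by rewrite mulr_ge0 ?addr_ge0.
  have XL : X <= L / 2.
    have Xl0 : 0 <= 2 * X / l by rewrite divr_ge0 ?(ltW l0) // mulr_ge0.
    have := archi_boundP Xl0; rewrite ltr_pdivrMr // => Xb.
    have : (Num.bound (2 * X / l))%:R * l <= L.
      rewrite /L /theta mulrA ler_wpM2r ?(ltW l0) // -natrM ler_nat.
      by rewrite (leq_trans (ltnW jj0)) // (leq_trans (leq_pmull j n0)) // leq_pmulr.
    by lra.
  have := expR_ge1Dx (L / 2).
  have : expR (- (L / 2)) <= 1 by rewrite -expR0 ler_expR oppr_le0 divr_ge0 // ltW.
  by lra.
have Gw := DG _ Dw.
have E0R : 0 < E%:R :> R by lra.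
have [m [p [mp [_ wg]]]] := word_axis E0R L0 cb mw.
exists w, (semicircle mp); split; last 2 first.
- exact: semicircle_geodesic.
- move=> s; rewrite -wg; congr (semicircle _ (_ + _)).
  by rewrite /L /theta !natrM; ring.
split=> // -[h [k [Gh _ k2]]].
(* The root [h] is only known to lie in [G], but so does the conjugate of [T ^+ E] by it, and the
   [E]-th power of that conjugate falls into [D]. *)
have DP' : modular_group ((h * T ^+ E * h^-1) ^+ E)%g.
  apply/DP/GE; apply: subgroupM (subgroupV sG Gh) => //.
  by apply: subgroupM => //; exact: DG.
apply: (word_not_power E0R sE L0 cb big mw mS DP' _ k2).
by rewrite conj_expg mulgVK.
Qed.

End Commensurable.

(** * Conjugation into common position with PSL(2,Z), and transfer back to the surface *)

Theorem theorem1p5 (R : realType) (M : hyperbolic_surface R)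
    (hM : noncompact_arithmetic M) (l : R)
    (hl : ms_mem (primitive_length_spectrum M) l) (k : nat) :
  exists x : nat -> R,
    arith_progression_in (primitive_length_spectrum M) k x /\
    forall j : nat, (1 <= j <= k)%N -> exists m : int, x j = m%:~R * l.
Proof.
have [_ [D0 [sD0 [g1 fi1] [g2 fi2]]]] := hM.
(* Conjugation by [g] carries the copy of [D0] inside the deck group onto its copy inside the
   modular group, so the conjugated deck group [G] contains the latter. *)
have [g gg1] : exists g : isom R, forall y,
    (g * (g1 * y * g1^-1) * g^-1 = g2 * y * g2^-1)%g.
  by exists (g2 * g1^-1)%g => y; rewrite !invgM !invgK !mulgA !mulgVK.
have sM := deck_subgroup M.
pose G := [set (g * f * g^-1)%g | f in deck M].
pose D := [set (g2 * f * g2^-1)%g | f in D0].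
have sG : is_subgroup G by exact: subgroup_conj.
have sD : is_subgroup D by exact: subgroup_conj.
have DG : D `<=` G.
  by move=> _ [y Dy <-]; exists (g1 * y * g1^-1)%g => //; apply: fi1.1; exists y.
have [N1 N10 hN1] := finite_index_expg (subgroup_conj g1 sD0) fi1.
have [N2 N20 hN2] := finite_index_expg sD fi2.
have GE f : G f -> D (f ^+ (N1 * N2))%g.
  move=> [x Mx <-]; rewrite expgnA; apply: subgroupX => //; rewrite conj_expg.
  have [y Dy <-] := hN1 x (fun n => subgroupX n sM Mx).
  by exists y.
have [T [V [mT mV PT PV]]] := modular_translations R.
have DX x : (forall n, modular_group (x ^+ n)%g) -> D (x ^+ (N1 * N2))%g.
  by move=> Px; rewrite mulnC expgnA; apply: subgroupX => //; exact: hN2.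
have E0 : (0 < N1 * N2)%N by rewrite muln_gt0 N10.
case: hl => -[[C l'] [/= [f0 [Mf0 _] ->] [l0 [f [c [[h Mh fE] gc cf]]]]]] /= ll.
subst l'.
have Mf : deck M f.
  rewrite -fE; apply: subgroupM => //; first exact: subgroupM.
  exact: subgroupV.
have cf' t : (g \o c) (t + l) = (g * f * g^-1)%g ((g \o c) t).
  have -> : (g * f * g^-1)%g ((g \o c) t) = g (f ((g^-1 * g)%g (c t))) by [].
  by rewrite mulVg /= cf.
have Gf : G (g * f * g^-1)%g by exists f.
have [n0 [j0 [n00 H]]] := primitive_translations sG sD DG fi2.1 E0 GE mT mV
  (DX _ PT) (DX _ PV) Gf l0 (geodesic_isom g gc) cf'.
(* The offset [j0] puts every multiplier in the range where the words are primitive; the common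
   difference is [n0%:R * l]. *)
exists (fun j => (n0 * (j + j0))%:R * l); split; last first.
  by move=> j _; exists (n0 * (j + j0))%:Z.
split.
- exists (n0%:R * l), ((n0 * j0)%:R * l) => j _.
  by rewrite mulnDr natrD natrM; ring.
- by move=> i j _ ij _; rewrite ltr_pM2r // ltr_nat ltn_pmul2l // ltn_add2r.
move=> j /andP[j1 _].
have [f' [g' [[[x Mx fx] prim] gg' gf']]] := H (j + j0)%N (leq_addl _ _).
(* Here [f'] is [g * x * g^-1], so a root of [x] in the deck group would conjugate to a root of [f']
   in [G]. *)
have px : primitive_class (deck M) (conj_class (deck M) x).
  exists x => //; split=> // -[y [n [My yx n2 xE]]].
  apply: prim; exists (g * y * g^-1)%g, n; split=> //.
  - by exists y.
  - by rewrite -fx => /mulIg /mulgI.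
  - by rewrite -fx xE conj_expg.
have lx : closed_geodesic_lengths (conj_class (deck M) x) ((n0 * (j + j0))%:R * l).
  split; first by rewrite mulr_gt0 // ltr0n muln_gt0 n00 addn_gt0 j1.
  exists x, ((g^-1)%g \o g'); split.
  - by exists 1%g; [case: sM | rewrite mul1g invg1 mulg1].
  - exact: geodesic_isom.
  - have e : (g^-1 * f' = x * g^-1)%g by rewrite -fx !mulgA mulVg mul1g.
    by move=> t; have := congr1 (fun u : isom R => u (g' t)) e; rewrite /= gf'.
by exists (exist _ (conj_class (deck M) x, (n0 * (j + j0))%:R * l) (conj px lx)).
Qed.
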